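(* There is a LERF group $G$, isomorphic to a split extension of $\mathbb{Z}^4$ by $SL_2(\mathbb{Z})$ (that is, to a semidirect product $\mathbb{Z}^4 \rtimes SL_2(\mathbb{Z})$), and finitely generated subgroups $H,K$ of $G$ such that $H \cap K=\{1\}$ and the double coset $HK$ is separable in $G$, but the double coset $H'K$ is not separable in $G$ for some finite index subgroup $H'$ of $H$. Moreover, the intersection $H \cap K$ is not profinitely tractable in $G$, and $G$ does not have the Wilson-Zalesskii property.
   Context: The profinite topology on a group $G$ is the topology in which the finite index normal subgroups of $G$ form a basis of open neighborhoods of the identity. A subset of $G$ is separable in $G$ if it is closed in this topology. A group is LERF if all its finitely generated subgroups are separable. For subsets $A,B \subseteq G$, $AB=\{ab \mid a\in A,\ b\in B\}$. For subgroups $H,K$ of $G$, the intersection $H\cap K$ is profinitely tractable in $G$ if for every finite index normal subgroup $M$ of $G$ there exists a finite index normal subgroup $N$ of $G$ such that $N\subseteq M$ and $HN\cap KN\subseteq (H\cap K)M$ in $G$. A residually finite group $G$ has the Wilson-Zalesskii property if $\overline{H}\cap\overline{K}=\overline{H\cap K}$ for all finitely generated subgroups $H,K$ of $G$, where closures are taken in the profinite completion $\widehat{G}$ of $G$ (in which $G$ is naturally embedded). *)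

(* Defs.v *)
From HB Require Import structures.
From mathcomp Require Import all_boot all_order all_algebra.
From mathcomp Require Import all_classical.
From mathcomp Require Import reals topology.

Set Implicit Arguments.
Unset Strict Implicit.
Unset Printing Implicit Defensive.

Import GRing.Theory.

Local Open Scope group_scope.
Local Open Scope classical_set_scope.

Section Subgroups.
Variable G : groupType.
Implicit Types (A B H K M N S : set G) (x y g : G).

Definition subgroup H : Prop := group_closed [in H].

Definition fg_subgroup H : Prop :=
  exists2 S, finite_set S & H = smallest subgroup S.

Definition set_mulg A B : set G := [set a * b | a in A & b in B].

Definition lcoset N x : set G := [set x * n | n in N].

(* [finite_index H' H] is meant for subgroups H' contained in H. *)
Definition finite_index H' H : Prop := finite_set (lcoset H' @` H).

Definition finormal N : Prop :=
  [/\ subgroup N, (forall x g, N x -> N (x ^ g)) & finite_index N [set: G]].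

Lemma subgroupP H :
  subgroup H <-> H 1 /\ (forall x y, H x -> H y -> H (x * y^-1)).
Proof.
split=> -[H1 Hd]; split.
- exact: set_mem H1.
- by move=> x y Hx Hy; apply/set_mem/Hd; exact/mem_set.
- exact: mem_set H1.
- by move=> x y /set_mem Hx /set_mem Hy; apply/mem_set/Hd.
Qed.

Lemma subgroup1 H : subgroup H -> H 1.
Proof. by case/subgroupP. Qed.

Lemma subgroupV H x : subgroup H -> H x -> H x^-1.
Proof. by case/subgroupP => H1 Hd Hx; rewrite -[x^-1]mul1g; exact: Hd. Qed.

Lemma subgroupM H x y : subgroup H -> H x -> H y -> H (x * y).
Proof.
move=> sH Hx Hy; rewrite -[y]invgK; case/subgroupP: (sH) => _; apply=> //.
exact: subgroupV.
Qed.

Lemma lcosetE N x y : lcoset N x y <-> N (x^-1 * y).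
Proof.
split=> [[n Nn <-]|Ny]; first by rewrite mulKg.
by exists (x^-1 * y) => //; rewrite mulVKg.
Qed.

Lemma lcoset_refl N x : subgroup N -> lcoset N x x.
Proof. by move=> sN; apply/lcosetE; rewrite mulVg; exact: subgroup1. Qed.

Lemma lcoset_eq N x y : subgroup N -> N (x^-1 * y) -> lcoset N x = lcoset N y.
Proof.
move=> sN Nxy; apply/seteqP; split=> z /lcosetE Nz; apply/lcosetE.
  have -> : y^-1 * z = (x^-1 * y)^-1 * (x^-1 * z).
    by rewrite invgM invgK -!mulgA mulVKg.
  by apply: subgroupM => //; exact: subgroupV.
have -> : x^-1 * z = (x^-1 * y) * (y^-1 * z) by rewrite -!mulgA mulVKg.
exact: subgroupM.
Qed.

Lemma finormalT : finormal [set: G].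
Proof.
split=> //; first by apply/subgroupP.
apply: (@sub_finite_set _ _ [set [set: G]]); last exact: finite_set1.
move=> _ [x _ <-]; apply/seteqP; split=> y // _.
exact/lcosetE.
Qed.

Lemma finormalI M N : finormal M -> finormal N -> finormal (M `&` N).
Proof.
move=> [sM nM fM] [sN nN fN]; have sMN : subgroup (M `&` N).
  case/subgroupP: sM => M1 Md; case/subgroupP: sN => N1 Nd.
  by apply/subgroupP; split=> // x y [? ?] [? ?]; split; auto.
split=> //; first by move=> x g [Mx Nx]; split; [exact: nM|exact: nN].
pose I2 (p : set G * set G) := p.1 `&` p.2.
apply: (@sub_finite_set _ _ (I2 @` ((lcoset M @` setT) `*` (lcoset N @` setT)))).
  move=> _ [x _ <-]; exists (lcoset M x, lcoset N x).
    by split; exists x.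
  rewrite /I2 /=; apply/seteqP; split=> y.
    by case=> /lcosetE My /lcosetE Ny; exact/lcosetE.
  by case/lcosetE => My Ny; split; exact/lcosetE.
exact/finite_image/finite_setX.
Qed.

End Subgroups.

Section ProfiniteTopology.
Variable G : groupType.

Definition profinite : Type := G.

HB.instance Definition _ := Choice.on profinite.

(* A group topology is determined by its neighborhoods of 1: U is open when it
   contains, around each of its points x, a translate xN. *)
Definition profinite_open (U : set profinite) : Prop :=
  forall x : G, U x -> exists2 N : set G, finormal N & lcoset N x `<=` U.

Lemma profinite_openT : profinite_open setT.
Proof. by move=> x _; exists setT => //; exact: finormalT. Qed.

Lemma profinite_openI : setI_closed profinite_open.
Proof.
move=> U V oU oV x [/oU [M fM MU] /oV [N fN NV]].
exists (M `&` N); first exact: finormalI.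
by move=> y /lcosetE [My Ny]; split; [apply: MU|apply: NV]; exact/lcosetE.
Qed.

Lemma profinite_open_bigU (I : Type) (f : I -> set profinite) :
  (forall i, profinite_open (f i)) -> profinite_open (\bigcup_i f i).
Proof.
move=> of_ x [i _ /of_ [N fN Nf]]; exists N => // y /Nf fy.
by exists i.
Qed.

HB.instance Definition _ := isOpenTopological.Build profinite
  profinite_openT profinite_openI profinite_open_bigU.

Definition separable (A : set G) : Prop := closed (A : set profinite).

Definition residually_finite : Prop :=
  forall g : G, g <> 1 -> exists2 N : set G, finormal N & ~ N g.

Definition LERF : Prop := forall H : set G, fg_subgroup H -> separable H.

Definition profinitely_tractable (H K : set G) : Prop :=
  forall M : set G, finormal M ->
  exists N : set G, [/\ finormal N, N `<=` M &
    set_mulg H N `&` set_mulg K N `<=` set_mulg (H `&` K) M].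

Lemma LERF_residually_finite : LERF -> residually_finite.
Proof.
move=> lerfG g g1.
have s1 : subgroup [set 1 : G].
  by apply/subgroupP; split=> // x y -> ->; rewrite mulgV.
have fg1 : fg_subgroup [set 1 : G].
  exists set0; first exact: finite_set0.
  apply/seteqP; split=> [x -> S [sS _]|]; first exact: subgroup1.
  by apply: smallest_sub.
have := lerfG _ fg1; rewrite /separable -openC => o1.
have [N fN Ng] : exists2 N : set G, finormal N & lcoset N g `<=` ~` [set 1].
  by apply: (o1 : profinite_open _).
exists N => // Ng1; apply: (Ng 1) => //; apply/lcosetE.
by rewrite mulg1; apply: subgroupV => //; case: fN.
Qed.

End ProfiniteTopology.

Section ProfiniteCompletion.
Variable G : groupType.

Definition finormal_of : choiceType := set_type [set N : set G | finormal N].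

Definition quotient_of (N : finormal_of) : discreteTopologicalType :=
  discrete_topology (set_type (range (lcoset (set_val N)))).

Definition compatible : set (prod_topology quotient_of) :=
  [set x | forall N M : finormal_of,
     set_val N `<=` set_val M -> (set_val (x N) : set G) `<=` set_val (x M)].

(* The inverse limit of the finite discrete quotients G/N; only its topology
   matters for closures, so its group structure is left out. *)
Definition profinite_completion : topologicalType := set_type compatible.

Definition to_quotient (g : G) (N : finormal_of) : quotient_of N :=
  SigSub (mem_set (imageT (lcoset (set_val N)) g)).

Lemma to_quotient_compatible (g : G) :
  compatible (to_quotient g : prod_topology quotient_of).
Proof.
move=> N M NM y; rewrite !set_valE /= => /lcosetE Ny.
by apply/lcosetE; exact: NM.
Qed.

Definition to_completion (g : G) : profinite_completion :=
  SigSub (mem_set (@to_quotient_compatible g)).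

Lemma to_completion_inj : residually_finite G -> injective to_completion.
Proof.
move=> rfG g h gh; apply: contrapT => neq_gh.
have [|N fN] := rfG (g^-1 * h).
  by move=> /(congr1 (fun x => g * x)); rewrite mulVKg mulg1 => /esym.
apply; apply/lcosetE.
pose N' : finormal_of := SigSub (mem_set fN).
have -> : lcoset N g = lcoset N h.
  exact: (congr1 (fun x : profinite_completion =>
                    set_val ((set_val x : prod_topology quotient_of) N')) gh).
by apply: lcoset_refl; have [] := fN.
Qed.

Definition wilson_zalesskii : Prop :=
  forall H K : set G, fg_subgroup H -> fg_subgroup K ->
    closure (to_completion @` H) `&` closure (to_completion @` K)
    = closure (to_completion @` (H `&` K)).

End ProfiniteCompletion.

Definition isomorphic (G H : groupType) : Prop :=
  exists f : {multiplicative G -> H}, bijective f.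

Section SpecialLinear.
Variables (n : nat) (R : comNzRingType).
Local Open Scope ring_scope.

Record SL : Type := MkSL { SLval :> 'M[R]_n ; _ : \det SLval == 1 }.

HB.instance Definition _ := [isSub for SLval].
HB.instance Definition _ := [Choice of SL by <:].

Lemma det_SL (A : SL) : \det A = 1.
Proof. by case: A => A /= /eqP. Qed.

Fact SL_one_subproof : \det (1%:M : 'M[R]_n) == 1.
Proof. by rewrite det1. Qed.

Fact SL_mul_subproof (A B : SL) : \det (A *m B) == 1.
Proof. by rewrite det_mulmx !det_SL mulr1. Qed.

Fact SL_inv_subproof (A : SL) : \det (\adj A) == 1.
Proof.
have := congr1 (fun M => \det M) (mul_mx_adj A).
by rewrite det_mulmx det_SL mul1r det1 => ->.
Qed.

Definition SL_one := MkSL SL_one_subproof.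
Definition SL_mul A B := MkSL (SL_mul_subproof A B).
Definition SL_inv A := MkSL (SL_inv_subproof A).

Fact SL_mulA : associative SL_mul.
Proof. by move=> A B C; apply/val_inj; rewrite /= mulmxA. Qed.
Fact SL_mul1 : left_id SL_one SL_mul.
Proof. by move=> A; apply/val_inj; rewrite /= mul1mx. Qed.
Fact SL_mulr1 : right_id SL_one SL_mul.
Proof. by move=> A; apply/val_inj; rewrite /= mulmx1. Qed.
Fact SL_mulV : left_inverse SL_one SL_inv SL_mul.
Proof. by move=> A; apply/val_inj; rewrite /= mul_adj_mx det_SL. Qed.
Fact SL_mulrV : right_inverse SL_one SL_inv SL_mul.
Proof. by move=> A; apply/val_inj; rewrite /= mul_mx_adj det_SL. Qed.

HB.instance Definition _ :=
  isGroup.Build SL SL_mulA SL_mul1 SL_mulr1 SL_mulV SL_mulrV.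

End SpecialLinear.

(* Actions of Q on V by group automorphisms; bijectivity of each [zact a]
   follows from the two axioms. *)
Record zaction (Q : groupType) (V : zmodType) : Type := ZAction {
  zact :> Q -> {additive V -> V};
  zact1 : forall v, zact 1 v = v;
  zactM : forall a b v, zact (a * b) v = zact a (zact b v)
}.

Section SemidirectProduct.
Variables (Q : groupType) (V : zmodType).

(* The alias keeps track of the action, which determines the product. *)
Definition sdprod (phi : zaction Q V) : Type := (V * Q)%type.

Variable phi : zaction Q V.
Local Notation P := (sdprod phi).

HB.instance Definition _ := Choice.copy P (V * Q)%type.

Definition sd_one : P := (0%R, 1).
Definition sd_mul (x y : P) : P :=
  ((x.1 + phi x.2 y.1)%R, x.2 * y.2).
Definition sd_inv (x : P) : P := ((- phi (x.2^-1)%g x.1)%R, x.2^-1).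

Fact sd_mulA : associative sd_mul.
Proof.
by move=> [u a] [v b] [w c]; rewrite /sd_mul /= zactM raddfD addrA mulgA.
Qed.
Fact sd_mul1 : left_id sd_one sd_mul.
Proof. by move=> [u a]; rewrite /sd_mul /= zact1 add0r mul1g. Qed.
Fact sd_mulr1 : right_id sd_one sd_mul.
Proof. by move=> [u a]; rewrite /sd_mul /= raddf0 addr0 mulg1. Qed.
Fact sd_mulV : left_inverse sd_one sd_inv sd_mul.
Proof. by move=> [u a]; rewrite /sd_mul /= addNr mulVg. Qed.
Fact sd_mulrV : right_inverse sd_one sd_inv sd_mul.
Proof.
by move=> [u a]; rewrite /sd_mul /= raddfN -zactM mulgV zact1 subrr.
Qed.

HB.instance Definition _ :=
  isGroup.Build P sd_mulA sd_mul1 sd_mulr1 sd_mulV sd_mulrV.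

End SemidirectProduct.

(* Main.v *)
Require Import Defs.
From HB Require Import structures.
From mathcomp Require Import all_boot all_order all_algebra.
From mathcomp Require Import zify ring lra.
From mathcomp Require cyclic.
From mathcomp Require Import all_classical.
From mathcomp Require Import reals topology.

Set Implicit Arguments.
Unset Strict Implicit.
Unset Printing Implicit Defensive.

Import Order.TTheory GRing.Theory Num.Theory.

(** Let V be the additive group of integral two by two matrices, on which SL2(Z)
acts by left multiplication, and let G = V ><| SL2(Z). The pair (a, q) acts on V
as the affine map m |-> a + q m. The subgroups are the stabilizers H of the zero
matrix (the standard complement SL2(Z)) and K of the identity matrix 1, which is
its conjugate by a translation. Both are finitely generated, and an affine map
fixing 0 and 1 is trivial because its linear part q satisfies q 1 = 1.

For a subset H' of H, an element x lies in H'K if and only if x sends 1 into the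
orbit H'1, that is, into the set H' itself seen inside V. For H' = H this set is
given by the equation det = 1, which can be tested modulo integers, so HK is
separable. For a subgroup H' of finite index in SL2(Z), the closure of H' in V
is its closure in the congruence topology; so H'K is not separable as soon as H'
is not closed for congruences. The failures of tractability and of the
Wilson-Zalesskii property have the same origin: if h in SL2(Z) is 1 modulo c,
then h and its copy in K, which is the conjugate of h by a translation, differ
by a translation by a multiple of c. Hence a limit in the profinite completion
of elements of SL2(Z) which tend to 1 for congruences lies in the closures of
both H and K, and it can be nontrivial.

Such elements come from Hsu's test for congruence subgroups. Let T and L be the
elementary unipotent matrices. If y is 0 modulo a power of 2 and 2y is 1 modulo
an odd number b, then (T^(4y) L^(-y))^6 is 1 modulo both numbers: modulo b, the
matrix in parentheses is T^2 L^(-1/2), which has trace 1 and determinant 1, hence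
order 6 (half_word_congruence). The exponents 2^(m! - 1) satisfy these
conditions for all moduli at most m and stabilize modulo each integer, so the
words converge in the profinite completion. An action of SL2(Z) on nine points,
in which T and L have order 7, does not kill the limit (noncongruence_subgroup).

To construct finite quotients of SL2(Z), one needs that s^4 = 1 and s^2 = u^3
are defining relations (SL2Z_action), which is proved by a ping-pong argument on
Z^2 (nform_faithful). The same universal property shows that SL2(Z) is LERF
(LERF_SL2Z): given a finitely generated subgroup, a finite piece of its coset
action is completed to a finite action. That G is LERF (LERF_sdprod) follows by
reduction modulo nV, using that finite index subgroups of finitely generated
groups are finitely generated (fg_subgroup_finite_index) and that every subgroup
of Z^k is the intersection of the subgroups L + n Z^k
(rV_subgroups_separable). *)

(** * Finite index and finitely generated subgroups *)

Section Generation.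
Local Open Scope group_scope.
Local Open Scope classical_set_scope.
Variable G : groupType.
Implicit Types (A H K N S : set G) (x y g : G).

Lemma subgroup_smallest (S : set G) : subgroup (smallest (@subgroup G) S).
Proof.
apply/subgroupP; split=> [K [sK _]|x y Hx Hy K [sK SK]]; first exact: subgroup1.
by apply: subgroupM => //; [|apply: subgroupV => //]; [exact: Hx|exact: Hy].
Qed.

Lemma fg_is_subgroup H : fg_subgroup H -> subgroup H.
Proof. by case=> S _ ->; exact: subgroup_smallest. Qed.

Lemma subgroupI H K : subgroup H -> subgroup K -> subgroup (H `&` K).
Proof.
move=> sH sK; apply/subgroupP; split; first by split; exact: subgroup1.
by move=> x y [? ?] [? ?]; split; apply: subgroupM => //; exact: subgroupV.
Qed.

Lemma subgroupX H x n : subgroup H -> H x -> H (x ^+ n).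
Proof.
move=> sH Hx; elim: n => [|n IH]; first by rewrite expg0; exact: subgroup1.
by rewrite expgS; exact: subgroupM.
Qed.

Lemma lcosetM (C : set G) x y : lcoset C (x * y) = lcoset (lcoset C y) x.
Proof.
apply/seteqP; split=> z.
  by move=> [c Cc <-]; exists (y * c); [exists c|rewrite mulgA].
by move=> [_ [c Cc <-] <-]; exists c => //; rewrite mulgA.
Qed.

Lemma lcoset1 (C : set G) : lcoset C 1 = C.
Proof.
by apply/seteqP; split=> z; [move=> [c Cc <-]; rewrite mul1g|exists z; rewrite ?mul1g].
Qed.

Lemma separableP A :
  separable A <-> forall x, ~ A x -> exists2 N, finormal N & lcoset N x `<=` ~` A.
Proof.
rewrite /separable -openC; split=> [oA x Ax|oA].
  by have : profinite_open (~` A) := oA; apply.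
by change (profinite_open (~` A)).
Qed.

(** The fibres of f choose a representative for each of the finitely many values
taken on H. *)
Lemma finite_index_of_separating (F : finType) (f : G -> F) H N :
  subgroup N ->
  (forall x y, H x -> H y -> f x = f y -> N (x^-1 * y)) -> finite_index N H.
Proof.
move=> sN fN; pose g (i : F) := lcoset N (xget 1 [set x | H x /\ f x = i]).
apply: (@sub_finite_set _ _ (range g)); last exact: finite_image.
move=> _ [x Hx <-]; exists (f x) => //; apply: lcoset_eq => //.
by case: xgetP => [y _ [Hy fy]|/(_ x) //]; [exact: fN|case].
Qed.

Lemma finite_indexI H N : subgroup H -> finormal N -> finite_index (H `&` N) H.
Proof.
move=> sH [sN _ fN].
apply: (@sub_finite_set _ _
  ((fun C => lcoset (H `&` N) (xget 1 (C `&` H))) @` (lcoset N @` setT))).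
  move=> _ [x Hx <-]; exists (lcoset N x); first by exists x.
  case: xgetP => [y _ [xy Hy]|/(_ x) []]; last by split=> //; exact: lcoset_refl.
  apply: lcoset_eq; first exact: subgroupI.
  split; first by apply: subgroupM => //; exact: subgroupV.
  by rewrite -[y^-1 * x]invgK invgM invgK; apply: subgroupV => //; exact/lcosetE.
exact: finite_image.
Qed.

(** Schreier's lemma. The generators are the products p (t p)^-1, where p = c s
with c in the transversal and s a generator of H. *)
Lemma fg_subgroup_finite_index H H0 :
  fg_subgroup H -> subgroup H0 -> H0 `<=` H -> finite_index H0 H ->
  fg_subgroup H0.
Proof.
move=> fgH sH0 H0H fin; have sH := fg_is_subgroup fgH.
case: fgH => S finS HE.
(* [t x] represents the coset H0 x; it must be 1 on H0 itself. *)
pose t x : G := if `[< H0 x >] then 1 else xget 1 [set y | H y /\ H0 (y * x^-1)].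
have tP x : H x -> H (t x) /\ H0 (t x * x^-1).
  move=> Hx; rewrite /t; case: asboolP => [H0x|_].
    by split; [exact: subgroup1|rewrite mul1g; exact: subgroupV].
  case: xgetP => [y _ //|/(_ x) []]; split=> //.
  by rewrite mulgV; exact: subgroup1.
have t_eq x y : H x -> H y -> H0 (x * y^-1) -> t x = t y.
  move=> Hx Hy Hxy; rewrite /t.
  have eqH z : H0 (z * x^-1) <-> H0 (z * y^-1).
    have -> : z * y^-1 = (z * x^-1) * (x * y^-1) by rewrite -!mulgA mulKg.
    split=> [Hz|Hz]; first exact: subgroupM.
    rewrite -[z * x^-1](mulgK (x * y^-1)); apply: subgroupM => //.
    exact: subgroupV.
  have eq1 : H0 x <-> H0 y.
    have := eqH 1; rewrite !mul1g => e; split=> Hz.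
      by rewrite -[y]invgK; apply: subgroupV => //; apply/e; exact: subgroupV.
    by rewrite -[x]invgK; apply: subgroupV => //; apply/e; exact: subgroupV.
  case: asboolP => Hx0; case: asboolP => Hy0 //; try by exfalso; tauto.
  congr xget; apply/seteqP; split=> z [Hz Hz']; split=> //; exact/eqH.
have finT : finite_set (t @` H).
  apply: (@sub_finite_set _ _
    ((fun C => t ((xget 1 (C `&` H))^-1)) @` (lcoset H0 @` H))); last exact: finite_image.
  move=> _ [x Hx <-]; exists (lcoset H0 x^-1).
    by exists x^-1 => //; exact: subgroupV.
  case: xgetP => [y _ [xy Hy]|/(_ x^-1) []].
    apply: t_eq => //; first exact: subgroupV.
    rewrite -invgM; apply: subgroupV => //.
    by move/lcosetE: xy; rewrite invgK.
  by split; [exact: lcoset_refl|exact: subgroupV].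
pose gen (p : G * G) := p.1 * p.2 * (t (p.1 * p.2))^-1.
exists (gen @` ((t @` H) `*` S)); first exact/finite_image/finite_setX.
set H1 := smallest _ _.
have sH1 : subgroup H1 by exact: subgroup_smallest.
have SH x : S x -> H x by rewrite HE => Sx K [_]; apply.
have genH1 c s : H c -> S s -> H1 (t c * s * (t (t c * s))^-1).
  move=> Hc Ss; apply: sub_gen_smallest; exists (t c, s) => //; split=> //.
  by exists c.
have HtT c s : H c -> S s -> t (t c * s) = t (c * s).
  move=> Hc Ss; have [Htc H0c] := tP _ Hc.
  apply: t_eq; try exact: (subgroupM sH _ (SH _ _)).
  by rewrite invgM mulgA mulgK.
apply/seteqP; split; last first.
  apply: smallest_sub => // _ [[_ s] [/= [c Hc <-] Ss] <-]; rewrite /gen /=.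
  have [Htc _] := tP _ Hc.
  have [_ h] := tP _ (subgroupM sH Htc (SH _ Ss)).
  by rewrite -[_ * _^-1]invgK; apply: subgroupV => //; rewrite invgM invgK.
(* E is the union of the cosets H1 (t c). It contains 1 and is stable under right
   multiplication by H, so it is H; then the elements of H0 lie in H1. *)
pose E := [set x | exists2 k, H1 k & exists2 c, H c & x = k * t c].
have E1 : E 1.
  exists 1; first exact: subgroup1.
  exists 1; first exact: subgroup1.
  rewrite mul1g /t; case: asboolP => // n1; case: n1; exact: subgroup1.
pose R := [set x | H x /\ forall y, E y -> E (y * x) /\ E (y * x^-1)].
have HR : H `<=` R.
  rewrite {1}HE; apply: (@smallest_sub _ (@subgroup G) S R); last first.
    move=> s Ss; split; first exact: SH.
    move=> _ [k Hk [c Hc ->]]; have [Htc H0c] := tP _ Hc; split.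
      exists (k * (t c * s * (t (t c * s))^-1)).
        by apply: (subgroupM sH1) => //; exact: genH1.
      exists (t c * s); first exact: (subgroupM sH Htc (SH _ Ss)).
      by rewrite !mulgA mulgVK.
    pose d := t c * s^-1.
    have Hd : H d by apply: subgroupM => //; apply: subgroupV => //; exact: SH.
    have tdE : t (t d * s) = t c.
      by rewrite HtT // /d mulgVK; apply: t_eq => //.
    exists (k * (t d * s * (t c)^-1)^-1).
      apply: (subgroupM sH1) => //; apply: (subgroupV sH1).
      by rewrite -tdE; exact: genH1.
    exists d => //.
    by rewrite !invgM invgK !mulgA mulgVK.
  apply/subgroupP; split.
    by split; [exact: subgroup1|move=> y Ey; rewrite invg1 mulg1].
  move=> x y [Hx Ex] [Hy Ey]; split; first by apply: subgroupM => //; exact: subgroupV.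
  move=> z Ez; split; first by rewrite mulgA; apply Ey; apply Ex.
  by rewrite invgM invgK mulgA; apply Ex; apply Ey.
move=> x H0x; have [_ /(_ 1 E1)] := HR _ (H0H _ H0x); rewrite mul1g => -[+ _].
move=> [k Hk [c Hc xE]].
have H1H0 : H1 `<=` H0.
  apply: smallest_sub => // _ [[_ s] [/= [d Hd <-] Ss] <-]; rewrite /gen /=.
  have [Htd _] := tP _ Hd.
  have [_ h] := tP _ (subgroupM sH Htd (SH _ Ss)).
  by rewrite -[_ * _^-1]invgK; apply: subgroupV => //; rewrite invgM invgK.
have H0tc : H0 (t c).
  have -> : t c = k^-1 * x by rewrite xE mulKg.
  by apply: subgroupM => //; apply: subgroupV => //; exact: H1H0.
have H0c : H0 c.
  have [_ h] := tP _ Hc.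
  rewrite -[c]invgK -[c^-1](mulKg (t c)); apply: subgroupV => //.
  by apply: subgroupM => //; exact: subgroupV.
move: xE; rewrite /t; case: asboolP => // _; rewrite mulg1 => ->.
exact: Hk.
Qed.

(** Among the first powers of x, two lie in the same coset of N; the exponent is a
factorial so as to serve all x at once. *)
Lemma finormal_exponent N :
  finormal N -> exists2 c, (0 < c)%N & forall x, N (x ^+ c).
Proof.
move=> [sN nN /finite_seqP [cs csE]].
exists (size cs)`!; first exact: fact_gt0.
move=> x; pose r := [seq lcoset N (x ^+ i) | i <- iota 0 (size cs).+1].
have : ~~ uniq r.
  have sub_r : {subset r <= cs}.
    move=> C /mapP [i _ ->].
    have : (lcoset N @` setT) (lcoset N (x ^+ i)) by exists (x ^+ i).
    by rewrite csE.
  apply/negP => /uniq_leq_size /(_ sub_r).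
  by rewrite size_map size_iota ltnn.
case/(uniqPn set0) => i [j [lt_ij]]; rewrite size_map size_iota => lt_j.
have lt_i := ltn_trans lt_ij lt_j.
rewrite !(nth_map 0%N) ?size_iota // !nth_iota // !add0n => eqC.
have : lcoset N (x ^+ i) (x ^+ j) by rewrite eqC; exact: lcoset_refl.
move/lcosetE; rewrite -(subnKC (ltnW lt_ij)) expgnDr mulKg => Nx.
have /dvdnP [k ->] : j - i %| (size cs)`!.
  by apply: dvdn_fact; rewrite subn_gt0 lt_ij (leq_trans (leq_subr _ _)) // -ltnS.
by rewrite mulnC expgnA; exact: subgroupX.
Qed.

End Generation.

Section Morphisms.
Local Open Scope group_scope.
Local Open Scope classical_set_scope.
Variables (G1 G2 : groupType) (f : G1 -> G2).
Hypothesis fM : {morph f : x y / x * y}.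

Lemma morph1 : f 1 = 1.
Proof. by apply: (mulgI (f 1)); rewrite -fM !mulg1. Qed.

Lemma morphV x : f x^-1 = (f x)^-1.
Proof. by apply: (mulgI (f x)); rewrite -fM !mulgV morph1. Qed.

Lemma morphX x n : f (x ^+ n) = f x ^+ n.
Proof. by elim: n => [|n IH]; rewrite ?morph1 // !expgS fM IH. Qed.

Lemma subgroup_preim (N : set G2) : subgroup N -> subgroup (f @^-1` N).
Proof.
move=> sN; apply/subgroupP; split=> [|x y Nx Ny] /=.
  by rewrite morph1; exact: subgroup1.
by rewrite fM morphV; apply: subgroupM => //; exact: subgroupV.
Qed.

Lemma subgroup_image (H : set G1) : subgroup H -> subgroup (f @` H).
Proof.
move=> sH; apply/subgroupP; split.
  by exists 1; [exact: subgroup1|exact: morph1].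
move=> _ _ [x Hx <-] [y Hy <-]; exists (x * y^-1).
  by apply: subgroupM => //; exact: subgroupV.
by rewrite fM morphV.
Qed.

Lemma finormal_preim (N : set G2) : finormal N -> finormal (f @^-1` N).
Proof.
move=> [sN nN fN]; split; first exact: subgroup_preim.
  by move=> x g /= Nx; rewrite !(conjgE, fM, morphV) -conjgE; exact: nN.
apply: (@sub_finite_set _ _
  ((fun C => lcoset (f @^-1` N) (xget 1 (f @^-1` C))) @` (lcoset N @` setT))).
  move=> _ [x _ <-]; exists (lcoset N (f x)); first by exists (f x).
  case: xgetP => [y _|/(_ x) []]; last exact: lcoset_refl.
  move=> /lcosetE xy; apply/esym/lcoset_eq; first exact: subgroup_preim.
  by rewrite /= fM morphV.
exact: finite_image.
Qed.

Lemma fg_subgroup_image (H : set G1) : fg_subgroup H -> fg_subgroup (f @` H).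
Proof.
move=> [S finS HE]; exists (f @` S); first exact: finite_image.
apply/seteqP; split.
  set K := smallest _ _; have sub : H `<=` f @^-1` K.
    rewrite HE; apply: smallest_sub.
      exact/subgroup_preim/subgroup_smallest.
    by move=> s Ss; apply: sub_gen_smallest; exists s.
  by move=> _ [x Hx <-]; exact: sub.
apply: smallest_sub.
  by apply: subgroup_image; rewrite HE; exact: subgroup_smallest.
by move=> _ [s Ss <-]; exists s => //; rewrite HE; exact: sub_gen_smallest.
Qed.
End Morphisms.

Section Actions.
Local Open Scope group_scope.
Local Open Scope classical_set_scope.
Variables (G : groupType) (T : choiceType) (f : G -> T -> T).
Hypothesis f1 : forall x, f 1 x = x.
Hypothesis fM : forall g h x, f (g * h) x = f g (f h x).

Lemma subgroup_stab x : subgroup [set g | f g x = x].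
Proof.
apply/subgroupP; split=> [|g h gx hx] /=; first exact: f1.
have e : f h^-1 x = x by rewrite -{1}hx -fM mulVg f1.
by rewrite fM e.
Qed.

(** The kernel of the action on a finite invariant set is the source of all the
finite quotients used below. *)
Lemma finormal_fix (r : seq T) :
  (forall g x, x \in r -> f g x \in r) ->
  finormal [set g | forall x, x \in r -> f g x = x].
Proof.
move=> fr; have sN : subgroup [set g | forall x, x \in r -> f g x = x].
  apply/subgroupP; split=> [x _ /=|g h gx hx x xr /=]; first exact: f1.
  by have /subgroupP [_] := subgroup_stab x; apply; [exact: gx|exact: hx].
split=> //.
  move=> g h gx x xr; rewrite /= conjgE !fM gx; last exact: fr.
  by rewrite -fM mulVg f1.
pose n := size r.
pose F g : {ffun 'I_n -> 'I_n.+1} :=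
  [ffun i => inord (index (f g (tnth (in_tuple r) i)) r)].
apply: (@finite_index_of_separating _ _ F) => // g h _ _ /ffunP Fgh x xr /=.
suff fgh : f g x = f h x by rewrite fM -fgh -fM mulVg f1.
have ltx : (index x r < n)%N by rewrite index_mem.
have := Fgh (Ordinal ltx); rewrite !ffunE (tnth_nth x) /= nth_index //.
move/(congr1 val); rewrite /= !inordK ?ltnS ?index_size //.
by move/(congr1 (nth x r)); rewrite !nth_index ?fr.
Qed.
End Actions.

(** * Groups generated by s and u with s^4 = 1 and s^2 = u^3 *)

Section Words.
Local Open Scope nat_scope.
Variables (X : Type) (s u : X -> X).

Fixpoint word_act (w : seq bool) (x : X) : X :=
  if w is b :: w' then (if b then s else u) (word_act w' x) else x.

Lemma word_act_cat w1 w2 x : word_act (w1 ++ w2) x = word_act w1 (word_act w2 x).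
Proof. by elim: w1 => //= b w1 ->. Qed.

Hypothesis s4 : forall x, s (s (s (s x))) = x.
Hypothesis s2u3 : forall x, s (s x) = u (u (u x)).

Lemma u6 x : u (u (u (u (u (u x))))) = x.
Proof. by rewrite -!s2u3 s4. Qed.

Lemma us2 x : u (s (s x)) = s (s (u x)).
Proof. by rewrite !s2u3. Qed.

Fixpoint word_inv (w : seq bool) : seq bool :=
  if w is b :: w' then word_inv w' ++ nseq (if b then 3 else 5) b else [::].

Lemma word_invK w x : word_act (word_inv w) (word_act w x) = x.
Proof.
elim: w x => //= b w IH x; rewrite word_act_cat -[RHS]IH; congr word_act.
by case: b; rewrite /= ?s4 ?u6.
Qed.

Lemma word_actK w x : word_act w (word_act (word_inv w) x) = x.
Proof.
elim: w x => //= b w IH x; rewrite word_act_cat IH.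
by case: b; rewrite /= ?s4 ?u6.
Qed.

(** The normal form is z^e u^i (s u^j1) ... (s u^jk) s^d, where z = s^2 is central,
i <= 2 and each j is 1 or 2, encoded by false or true. *)
Record nform := NForm { nf_z : bool; nf_u : nat; nf_l : seq bool; nf_s : bool }.

Definition zpow (e : bool) (x : X) := if e then s (s x) else x.

Definition nform_act (n : nform) (x : X) : X :=
  zpow (nf_z n) (iter (nf_u n) u
    (foldr (fun (j : bool) y => s (iter (if j then 2 else 1) u y))
       (if nf_s n then s x else x) (nf_l n))).
End Words.

Section NormalForms.
Local Open Scope nat_scope.

Definition nf_mul_u (n : nform) : nform :=
  let: NForm z i l d := n in
  if i == 2 then NForm (~~ z) 0 l d else NForm z i.+1 l d.

Definition nf_mul_s (n : nform) : nform :=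
  let: NForm z i l d := n in
  match i, l with
  | 0, [::] => if d then NForm (~~ z) 0 [::] false else NForm z 0 [::] true
  | 0, j :: l' => NForm (~~ z) (if j then 2 else 1) l' d
  | i, _ => NForm z 0 ((i == 2) :: l) d
  end.

Fixpoint normal_form (w : seq bool) : nform :=
  if w is b :: w' then (if b then nf_mul_s else nf_mul_u) (normal_form w')
  else NForm false 0 [::] false.

Lemma nf_u_le2 w : (nf_u (normal_form w) <= 2)%N.
Proof.
elim: w => //= b w; case: (normal_form w) => z i l d /=; case: b => /=.
  by case: i => [|i] //=; case: l => [|j l] //=; [case: d|case: j].
by case: eqP => //=; lia.
Qed.

(** Only the relations are used, so the same normal form computes the action of a
word for every choice of s and u. *)
Lemma normal_formE X (s u : X -> X) :
  (forall x, s (s (s (s x))) = x) -> (forall x, s (s x) = u (u (u x))) ->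
  forall w x, word_act s u w x = nform_act s u (normal_form w) x.
Proof.
move=> s4 s2u3 w x; elim: w => //= b w ->; have := nf_u_le2 w.
case: (normal_form w) => z i l d /= i2; case: b => /=.
  case: i i2 => [|[|[|i]]] //= _.
  - case: l => [|j l] /=; rewrite /nform_act /=.
      by case: d; case: z => //=; rewrite s4.
    by case: j; case: z => //=; rewrite s4.
  - by rewrite /nform_act /=; case: z.
  - by rewrite /nform_act /=; case: z.
have us x' := us2 s2u3 x'.
by case: i i2 => [|[|[|i]]] //= _; rewrite /nform_act /=; case: z => //=;
  rewrite ?us -?s2u3 ?s4.
Qed.

End NormalForms.

Section PingPong.
Local Open Scope ring_scope.

(** The linear action of the two generators of SL2(Z) on Z^2. *)
Definition vS (v : int * int) : int * int := (- v.2, v.1).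
Definition vU (v : int * int) : int * int := (- v.2, v.1 + v.2).

Lemma vS4 v : vS (vS (vS (vS v))) = v.
Proof. by case: v => x y; rewrite /vS /= !opprK. Qed.

Lemma vS2U3 v : vS (vS v) = vU (vU (vU v)).
Proof. by case: v => x y; rewrite /vS /vU /=; congr pair; ring. Qed.

(** Up to sign, su and suu are the maps (x, y) |-> (x + y, y) and (x, x + y), which
preserve the positive quadrant and increase x + y. *)
Lemma nform_positive l (v : int * int) : 0 < v.1 -> 0 < v.2 ->
  let v' := foldr (fun (j : bool) y => vS (iter (if j then 2 else 1) vU y)) v l in
  exists (e : bool) (p q : int), [/\ v' = (if e then (- p, - q) else (p, q)), 0 < p, 0 < q
    & p + q >= v.1 + v.2 + (size l)%:Z].
Proof.
move=> v1 v2; elim: l => [|j l] /=; last case=> e [p [q [-> p0 q0 pq]]].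
  by exists false, v.1, v.2; split => //; [case: v v1 v2|lia].
exists (~~ e); case: j => /=.
  exists p, (p + q); case: e => /=; split; try lia; rewrite /vS /vU /=; congr pair; ring.
exists (p + q), q; case: e => /=; split; try lia; rewrite /vS /vU /=; congr pair; ring.
Qed.

(** Ping-pong: after a nonempty alternating part, the vector (1, 1) is up to sign
in the positive quadrant with a larger sum, and the remaining powers of u either
keep it there or move it to the quadrants where the coordinates have opposite
signs. The second vector (1, -1) is the one that s sends to (1, 1); it excludes
a final s. *)
Lemma nform_faithful n : (nf_u n <= 2)%N ->
  nform_act vS vU n (1, 1) = (1, 1) -> nform_act vS vU n (1, -1) = (1, -1) ->
  n = NForm false 0 [::] false.
Proof.
case: n => z i l d /= i2; rewrite /nform_act /= => n1 n2.
have [e [p [q [vE p0 q0 pq]]]] := @nform_positive l (1, 1) isT isT.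
have dF : d = false.
  apply/negP => dT; move: n2; rewrite dT.
  have -> : vS (1, -1) = (1, 1) by [].
  rewrite vE {vE n1}.
  by case: i i2 => [|[|[|i]]] //= _; case: z; case: e; rewrite /vS /vU /= => -[]; lia.
move: n1; rewrite dF vE => n1.
have [i0 [ze pq1]] : i = 0%N /\ z = e /\ p + q = 2.
  move: n1 {vE n2}.
  by case: i i2 => [|[|[|i]]] //= _; case: z; case: e; rewrite /vS /vU /= => -[]; lia.
have l0 : l = [::] by case: (l) pq => //= ? ?; lia.
move: vE; rewrite i0 l0 -ze /=.
by case: z {ze n1 n2} => // -[]; lia.
Qed.
End PingPong.

(** * Generators and relations of the modular group *)

Section TwoByTwo.
Variable R : comNzRingType.
Local Open Scope ring_scope.

Definition mx2 (a b c d : R) : 'M[R]_2 :=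
  \matrix_(i, j) if i == 0 then if j == 0 then a else b
                 else if j == 0 then c else d.

Lemma mx2_eta (A : 'M[R]_2) : A = mx2 (A 0 0) (A 0 1) (A 1 0) (A 1 1).
Proof.
apply/matrixP => i j; rewrite mxE.
by case: i => [[|[|i]] lti] //; case: j => [[|[|j]] ltj] //=;
  congr (A _ _); apply: val_inj.
Qed.

Lemma mulmx2 a b c d a' b' c' d' :
  mx2 a b c d *m mx2 a' b' c' d' =
  mx2 (a * a' + b * c') (a * b' + b * d') (c * a' + d * c') (c * b' + d * d').
Proof.
apply/matrixP => i j; rewrite !mxE !big_ord_recl big_ord0 !mxE addr0 /=.
by case: i => [[|[|i]] lti] //; case: j => [[|[|j]] ltj].
Qed.

Lemma det_mx2 a b c d : \det (mx2 a b c d) = a * d - b * c.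
Proof.
rewrite (expand_det_row _ 0) !big_ord_recl big_ord0 addr0.
rewrite /cofactor !det_mx11 !mxE /= expr0 expr1 mul1r mulN1r mulrN.
by congr (_ * _ - _ * _).
Qed.

Lemma mx2_1 : mx2 1 0 0 1 = 1%:M.
Proof. by rewrite [RHS]mx2_eta !mxE. Qed.

Definition sl2 a b c d (h : a * d - b * c = 1) : SL 2 R :=
  MkSL (introT eqP (etrans (det_mx2 a b c d) h)).
End TwoByTwo.

Section ModularGroup.
Local Open Scope ring_scope.
Local Notation Q := (SL 2 int).

Fact slS_subproof : (0 * 0 - (-1) * 1 : int) = 1. Proof. by []. Qed.
Fact slU_subproof : (0 * 1 - (-1) * 1 : int) = 1. Proof. by []. Qed.
Definition slS : Q := sl2 slS_subproof.
Definition slU : Q := sl2 slU_subproof.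

Lemma SL_valM (A B : Q) : SLval (A * B)%g = SLval A *m SLval B.
Proof. by []. Qed.
Lemma SL_val1 : SLval (1%g : Q) = 1%:M.
Proof. by []. Qed.

Lemma SL_inj (A B : Q) : SLval A = SLval B -> A = B.
Proof. exact: val_inj. Qed.

Lemma slS4 (x : Q) : (slS * (slS * (slS * (slS * x))) = x)%g.
Proof.
rewrite !mulgA -[RHS]mul1g; congr (_ * _)%g; apply: SL_inj.
rewrite !SL_valM SL_val1 /= !mulmx2 -mx2_1; congr mx2; by [].
Qed.

Lemma slS2U3 (x : Q) : (slS * (slS * x) = slU * (slU * (slU * x)))%g.
Proof.
rewrite !mulgA; congr (_ * _)%g; apply: SL_inj.
rewrite !SL_valM /= !mulmx2; congr mx2; by [].
Qed.

Definition word_eval (w : seq bool) : Q := word_act ( *%g slS) ( *%g slU) w 1%g.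

Lemma word_act_eval w x : word_act ( *%g slS) ( *%g slU) w x = (word_eval w * x)%g.
Proof.
elim: w => [|b w IH]; first by rewrite /word_eval mul1g.
by rewrite /word_eval /=; case: b; rewrite IH mulgA.
Qed.

Lemma word_eval_cat w1 w2 : word_eval (w1 ++ w2) = (word_eval w1 * word_eval w2)%g.
Proof. by rewrite /word_eval word_act_cat word_act_eval. Qed.

Lemma word_eval_inv w : word_eval (word_inv w) = (word_eval w)^-1%g.
Proof.
apply: (mulIg (word_eval w)); rewrite mulVg -word_act_eval.
exact: (word_invK slS4 slS2U3).
Qed.

Definition mul_vec (A : Q) (v : int * int) : int * int :=
  (A 0 0 * v.1 + A 0 1 * v.2, A 1 0 * v.1 + A 1 1 * v.2).

Lemma mul_vecS v : mul_vec slS v = vS v.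
Proof. by rewrite /mul_vec !mxE /= /vS; congr pair; ring. Qed.

Lemma mul_vecU v : mul_vec slU v = vU v.
Proof. by rewrite /mul_vec !mxE /= /vU; congr pair; ring. Qed.

Lemma mul_vec1 v : mul_vec 1%g v = v.
Proof. by case: v => x y; rewrite /mul_vec !mxE /=; congr pair; ring. Qed.

Lemma mul_vecM A B v : mul_vec (A * B)%g v = mul_vec A (mul_vec B v).
Proof.
rewrite /mul_vec SL_valM !mxE !big_ord_recl !big_ord0 /=.
have -> : lift ord0 ord0 = 1 :> 'I_2 by exact: val_inj.
by congr pair; ring.
Qed.

Lemma word_act_vec w v : word_act vS vU w v = mul_vec (word_eval w) v.
Proof.
elim: w => [|b w IH] /=; first by rewrite mul_vec1.
by case: b; rewrite IH /word_eval /= mul_vecM ?mul_vecS ?mul_vecU.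
Qed.

(** A word that is trivial in SL2(Z) fixes (1, 1) and (1, -1), so its normal form
is trivial, hence it acts trivially whenever the two relations hold. *)
Lemma word_eval_relation X (s u : X -> X) :
  (forall x, s (s (s (s x))) = x) -> (forall x, s (s x) = u (u (u x))) ->
  forall w, word_eval w = 1%g -> forall x, word_act s u w x = x.
Proof.
move=> s4 s2u3 w w1 x; rewrite (normal_formE s4 s2u3).
by rewrite [normal_form w]nform_faithful ?nf_u_le2 //;
  rewrite -(normal_formE vS4 vS2U3) word_act_vec w1 mul_vec1.
Qed.

Definition generated (A : Q) := exists w, word_eval w = A.

Lemma generatedM A B : generated A -> generated B -> generated (A * B)%g.
Proof. by move=> [w <-] [w' <-]; exists (w ++ w'); rewrite word_eval_cat. Qed.

Lemma generatedV A : generated A -> generated A^-1%g.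
Proof. by move=> [w <-]; exists (word_inv w); rewrite word_eval_inv. Qed.

Fact slT_subproof (k : int) : 1 * 1 - k * 0 = 1. Proof. by rewrite mulr0 subr0 mulr1. Qed.
Definition slT k : Q := sl2 (slT_subproof k).

Lemma slTD j k : (slT j * slT k)%g = slT (j + k).
Proof.
apply: SL_inj; rewrite SL_valM /= mulmx2; congr mx2; ring.
Qed.

Lemma slT0 : slT 0 = 1%g.
Proof. by apply: SL_inj; rewrite /= mx2_1. Qed.

Lemma slT1 : slT 1 = (slS * slS * slS * slU)%g.
Proof. by apply: SL_inj; rewrite !SL_valM /= !mulmx2; congr mx2. Qed.

Lemma slTX k n : (slT k ^+ n)%g = slT (k *+ n).
Proof.
by elim: n => [|n IH]; rewrite ?slT0 // expgS IH slTD mulrS.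
Qed.

Lemma slTV k : (slT k)^-1%g = slT (- k).
Proof. by apply: (mulgI (slT k)); rewrite mulgV slTD subrr slT0. Qed.

Lemma generatedS : generated slS.
Proof. by exists [:: true]; rewrite /word_eval /= mulg1. Qed.

Lemma generatedT k : generated (slT k).
Proof.
have gT n : generated (slT n%:Z).
  rewrite -[n%:Z]natz -slTX; elim: n => [|n IH]; first by exists [::].
  rewrite expgS; apply: generatedM => //; exists [:: true; true; true; false].
  by rewrite slT1 /word_eval /= !mulgA mulg1.
case: k => n; first exact: gT.
by rewrite NegzE -slTV; exact/generatedV/gT.
Qed.

(** Euclid's algorithm on the first column. *)
Lemma SL2Z_generated A : generated A.
Proof.
have [n] := ubnP (absz (A 1 0)%R); elim: n A => // n IH A ltn.
have : \det A = 1 by exact: det_SL.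
have := mx2_eta A; move: ltn.
set a := A 0 0; set b := A 0 1; set c := A 1 0; set d := A 1 1 => ltn AE.
rewrite AE det_mx2 => detA.
have [c0|c0] := eqVneq c 0.
  have [[a1 d1]|[a1 d1]] : (a = 1 /\ d = 1) \/ (a = -1 /\ d = -1).
    have ad : a * d = 1 by rewrite -detA c0 mulr0 subr0.
    have /eqP := congr1 absz ad; rewrite abszM muln_eq1 => /andP [/eqP ? /eqP ?].
    by have [a1|a1] : a = 1 \/ a = -1 by [lia]; [left|right]; rewrite a1 in ad *; lia.
    have -> : A = slT b; last exact: generatedT.
    by apply: SL_inj; rewrite AE a1 c0 d1.
  have -> : A = (slS * slS * slT (- b))%g.
    apply: SL_inj; rewrite AE a1 c0 d1 !SL_valM /= !mulmx2; congr mx2; ring.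
  apply: generatedM; last exact: generatedT.
  by apply: generatedM; exact: generatedS.
pose q := (a %/ c)%Z.
have gB : generated (slS * slT (- q) * A)%g.
  apply: IH; rewrite !SL_valM AE /= !mulmx2 mxE /=.
  rewrite !(mul0r, addr0, mul1r).
  have -> : a + - q * c = (a %% c)%Z by rewrite {1}(divz_eq a c); ring.
  have := ltz_mod a c0; have := modz_ge0 a c0; lia.
have -> : A = ((slS * slT (- q))^-1 * (slS * slT (- q) * A))%g by rewrite mulKg.
apply: generatedM => //; apply/generatedV/generatedM; first exact: generatedS.
exact: generatedT.
Qed.
End ModularGroup.

(** * SL2(Z) is LERF *)

Section UniversalProperty.
Local Notation Q := (SL 2 int).
Local Open Scope group_scope.

(** SL2(Z) is the amalgam of a cyclic group of order 4 and one of order 6 over the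
subgroup of order 2. *)
Theorem SL2Z_action (X : Type) (s u : X -> X) :
  (forall x, s (s (s (s x))) = x) -> (forall x, s (s x) = u (u (u x))) ->
  exists f : Q -> X -> X,
    [/\ forall x, f 1 x = x, forall A B x, f (A * B) x = f A (f B x)
      & forall w x, f (word_eval w) x = word_act s u w x].
Proof.
move=> s4 s2u3.
have wd w w' : word_eval w = word_eval w' -> word_act s u w =1 word_act s u w'.
  move=> ww' x; have : word_eval (word_inv w ++ w') = 1.
    by rewrite word_eval_cat word_eval_inv ww' mulVg.
  move/(word_eval_relation s4 s2u3)/(_ x); rewrite word_act_cat => e.
  by rewrite -[in LHS]e (word_actK s4 s2u3).
pose word A := sval (cid (SL2Z_generated A)).
have wordK A : word_eval (word A) = A by rewrite /word; case: cid.
exists (fun A => word_act s u (word A)); split.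
- by move=> x; rewrite (wd _ [::]) // wordK.
- move=> A B x; rewrite -word_act_cat; apply: wd.
  by rewrite word_eval_cat !wordK.
- by move=> w x; apply: wd; rewrite wordK.
Qed.
End UniversalProperty.

Section LERF_SL2Z.
Local Notation Q := (SL 2 int).
Local Open Scope group_scope.
Local Open Scope classical_set_scope.

Local Notation "q *: C" := (lcoset C q).

(** A finite set r of subsets of SL2(Z), stable under translation by u, does not
support an action of s: translation by s may leave r. The action is repaired on
two copies of r. On the part of r that s sends into r, both copies keep the given
action; on the rest, s exchanges the two copies in such a way that its square is
still translation by z = s^2. As the action of u is unchanged, the relations
hold. *)
Section Completion.
Variable r : seq (set Q).
Hypothesis rU : forall C, C \in r -> slU *: C \in r.

Let z := slS * slS.

Let zU : z = slU ^+ 3.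
Proof. by have := slS2U3 1; rewrite !mulg1 !expgS expg0 mulg1. Qed.

Let z2 : z * z = 1.
Proof. by have := slS4 1; rewrite !mulg1 /z -!mulgA. Qed.

Let zS : z * slS = slS * z.
Proof. by rewrite /z !mulgA. Qed.

Lemma mem_z C : (z *: C \in r) = (C \in r).
Proof.
have zr D : D \in r -> z *: D \in r.
  by move=> Dr; rewrite zU !expgS mulg1 !lcosetM; do !apply: rU.
by apply/idP/idP => [/zr|/zr //]; rewrite -lcosetM z2 lcoset1.
Qed.

Definition glue_s (x : set Q * bool) : set Q * bool :=
  if (x.1 \in r) == (slS *: x.1 \in r) then (slS *: x.1, x.2)
  else if x.2 then (z *: x.1, false) else (x.1, true).

Definition glue_u (x : set Q * bool) : set Q * bool := (slU *: x.1, x.2).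

Lemma glue_s2 x : glue_s (glue_s x) = (z *: x.1, x.2).
Proof.
case: x => C b; rewrite {2}/glue_s /=; case: ifPn => [/eqP rC|rC].
  by rewrite /glue_s /= -lcosetM -/z mem_z -rC eqxx.
by case: b; rewrite /glue_s /= ?mem_z -?lcosetM -?zS
  ?[lcoset C (z * _)]lcosetM ?mem_z (negbTE rC).
Qed.

Lemma glue_s4 x : glue_s (glue_s (glue_s (glue_s x))) = x.
Proof. by rewrite !glue_s2 -lcosetM z2 lcoset1; case: x. Qed.

Lemma glue_s2u3 x : glue_s (glue_s x) = glue_u (glue_u (glue_u x)).
Proof. by rewrite glue_s2 /glue_u /= zU !expgS expg0 mulg1 !lcosetM. Qed.

Lemma glue_s_mem x : x.1 \in r -> (glue_s x).1 \in r.
Proof.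
by rewrite /glue_s => xr; case: eqP => [<- //|_]; case: x.2; rewrite //= mem_z.
Qed.

Lemma glue_word_mem w x : x.1 \in r -> (word_act glue_s glue_u w x).1 \in r.
Proof.
by move=> xr; elim: w => //= -[] w IH; [exact: glue_s_mem|exact: rU].
Qed.

(** As long as a path in the coset graph stays in r, the repaired action follows
it. *)
Lemma glue_word w C :
  (forall k, word_eval (drop k w) *: C \in r) ->
  word_act glue_s glue_u w (C, false) = (word_eval w *: C, false).
Proof.
elim: w => [|b w IH] rw; first by rewrite /= lcoset1.
have -> : word_eval (b :: w) = (if b then slS else slU) * word_eval w.
  by rewrite /word_eval /=; case: b rw.
rewrite /= IH => [|k]; last exact: (rw k.+1).
have := rw 0%N; have := rw 1%N; rewrite /= drop0 [word_eval (b :: w)]/=.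
case: b rw => rw; rewrite /word_eval /= -/(word_eval w) lcosetM; last by [].
by rewrite /glue_s /= => -> ->.
Qed.

End Completion.

(** Let r contain all the cosets met by words for g and for the generators of H,
starting from the coset H. In the repaired action on two copies of r, the
subgroup H fixes the base point and g does not, so the kernel N of this finite
action is such that gN does not meet H. *)
Theorem LERF_SL2Z : LERF Q.
Proof.
move=> H fgH; have sH := fg_is_subgroup fgH.
case: fgH => S0 /finite_seqP [gs gsE] HE.
apply/separableP => g Hg.
pose word A := sval (cid (SL2Z_generated A)).
have wordK A : word_eval (word A) = A by rewrite /word; case: cid.
(* the cosets met by the suffixes of the words, before closing under u *)
pose r0 := flatten [seq [seq word_eval (drop k (word A)) *: H |
                          k <- iota 0 (size (word A)).+1] | A <- g :: gs].
pose r := [seq slU ^+ i *: C | i <- iota 0 6, C <- r0].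
have r0r C : C \in r0 -> C \in r.
  move=> Cr0; rewrite -[C]lcoset1 -(expg0 slU).
  by apply: (allpairs_f (fun i C => slU ^+ i *: C)).
have rU C : C \in r -> slU *: C \in r.
  case/allpairsP => -[i D] [/= i6 Dr0 ->]; rewrite -lcosetM -expgS.
  have [i5|i5] := ltnP i.+1 6.
    have i5' : i.+1 \in iota 0 6 by rewrite mem_iota.
    exact: (allpairs_f (fun i C => slU ^+ i *: C) i5' Dr0).
  have -> : i.+1 = 6%N by move: i6; rewrite (mem_iota 0 6); lia.
  have -> : slU ^+ 6 = 1.
    have := u6 slS4 slS2U3 1; by rewrite !mulg1.
  rewrite lcoset1; exact: r0r.
have r_word A k : A \in g :: gs -> word_eval (drop k (word A)) *: H \in r.
  move=> Ags; apply: r0r; apply/flatten_mapP; exists A => //.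
  have [kA|kA] := leqP k (size (word A)).
    by apply/mapP; exists k; rewrite // mem_iota ltnS.
  apply/mapP; exists (size (word A)); first by rewrite mem_iota ltnS leqnn.
  by rewrite drop_size drop_oversize // ltnW.
have [f [f1 fM fw]] := SL2Z_action (glue_s4 rU) (glue_s2u3 rU).
have fgs A : A \in g :: gs -> f A (H, false) = (A *: H, false).
  move=> Ags; rewrite -{1}[A]wordK fw glue_word ?wordK // => k.
  exact: r_word.
pose rr := [seq (C, b) | C <- r, b <- [:: false; true]].
have rrE x : (x \in rr) = (x.1 \in r).
  apply/allpairsP/idP => [[[C b] [/= Cr _ ->]] //|xr].
  by exists x; split=> //; [case: (x.2)|case: (x)].
exists [set A | forall x, x \in rr -> f A x = x].
  apply: finormal_fix => // A x; rewrite !rrE -[A]wordK fw.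
  exact: glue_word_mem.
have Hfix A : H A -> f A (H, false) = (H, false).
  suff sub : H `<=` [set A | f A (H, false) = (H, false)] by apply: sub.
  rewrite {1}HE; apply: smallest_sub; first exact: subgroup_stab.
  move=> s Ss; rewrite /= fgs; last first.
    by rewrite inE; apply/orP; right; move: Ss; rewrite gsE.
  have Hs : H s by rewrite HE; exact: sub_gen_smallest.
  congr pair; rewrite -[RHS]lcoset1; apply: lcoset_eq => //.
  by rewrite mulg1; exact: subgroupV.
move=> _ [n Nn <-] Hgn.
have Hr : (H, false) \in rr.
  rewrite rrE /=; have := r_word g (size (word g)) (mem_head _ _).
  by rewrite drop_size lcoset1.
have := Hfix _ Hgn; rewrite fM Nn // fgs ?mem_head // => -[gH].
by apply: Hg; rewrite -gH; exact: lcoset_refl.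
Qed.
End LERF_SL2Z.

(** * Subgroups of a free abelian group of finite rank *)

Section AdditiveSeparation.
Local Open Scope ring_scope.
Local Open Scope classical_set_scope.

Definition add_subgroup (V : zmodType) (L : set V) :=
  L 0 /\ forall x y, L x -> L y -> L (x - y).

(** Each subgroup L is the intersection of the subgroups L + nV with n > 0. *)
Definition add_subgroups_separable (V : zmodType) :=
  forall L : set V, add_subgroup L -> forall a, ~ L a ->
  exists2 n, (0 < n)%N & forall w, ~ L (a - w *+ n).

Section Facts.
Variables (V : zmodType) (L : set V).
Hypothesis sL : add_subgroup L.

Lemma add_subgroupN x : L x -> L (- x).
Proof. by case: sL => L0 LB Lx; rewrite -[- x]add0r; exact: LB. Qed.

Lemma add_subgroupD x y : L x -> L y -> L (x + y).
Proof. by move=> Lx /add_subgroupN Ly; rewrite -[y]opprK; apply sL.2. Qed.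

Lemma add_subgroupMn x n : L x -> L (x *+ n).
Proof.
move=> Lx; elim: n => [|n IH]; first exact: sL.1.
by rewrite mulrS; exact: add_subgroupD.
Qed.

Lemma add_subgroupMz x n : L x -> L (x *~ n).
Proof.
move=> Lx; case: n => n; first exact: add_subgroupMn.
by apply: add_subgroupN; exact: add_subgroupMn.
Qed.
End Facts.

Lemma int_subgroup_gen (D : set int) : add_subgroup D ->
  exists2 d, D d & forall x, D x -> (d %| x)%Z.
Proof.
move=> sD; have [D0|] := pselect (exists n, `[< D n.+1%:Z >]); last first.
  move=> nD; exists 0; first exact: sD.1.
  move=> x Dx; rewrite dvd0z; apply/eqP; apply: contrapT => x0; apply: nD.
  exists `|x|%N.-1; apply/asboolP; rewrite prednK ?absz_gt0; last exact/eqP.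
  by case: (intP x) Dx => [//|n Dn|n /(add_subgroupN sD)]; rewrite ?opprK.
have [n /asboolP Dn nmin] := ex_minnP D0; exists n.+1%:Z => // x Dx.
have n0 : n.+1%:Z != 0 by [].
have Dr : D (x %% n.+1%:Z)%Z.
  have := sD.2 _ _ Dx (add_subgroupMz sD (x %/ n.+1%:Z)%Z Dn).
  by rewrite mulrzz mulrC.
have := modz_ge0 x n0; have := ltz_mod x n0.
case E: (x %% n.+1%:Z)%Z Dr => [[|m]|m] // Dm.
- by move=> _ _; apply/dvdz_mod0P.
- by have := nmin m; move/asboolP: Dm => -> /(_ isT); lia.
Qed.

(** Induction on the rank. The first coordinates of L form a subgroup generated by
some d, the first coordinate of an element l0 of L. If d does not divide the first coordinate of
a, a modulus is found there. Otherwise subtract a multiple of l0 to make this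
coordinate zero, and apply the induction hypothesis to the elements of L with
first coordinate zero; if d is nonzero, the modulus obtained is multiplied by it,
so that the first coordinate of a relation can again be cancelled with l0. *)
Lemma rV_subgroups_separable k : add_subgroups_separable 'rV[int]_k.
Proof.
elim: k => [|k IH] L sL a La.
  by exists 1%N => // w _; apply: La; rewrite thinmx0; exact: sL.1.
pose c (x : 'rV[int]_k.+1) := x 0 0.
pose r (x : 'rV[int]_k.+1) : 'rV[int]_k := rsubmx (x : 'rV[int]_(1 + k)).
pose e (y : 'rV[int]_k) : 'rV[int]_k.+1 := row_mx (0 : 'rV_1) y.
have cE x : c x = 0 -> x = e (r x).
  move=> c0; rewrite -[LHS](@hsubmxK _ 1 1 k).
  have -> : lsubmx (x : 'rV_(1 + k)) = 0; last by [].
  apply/matrixP => i j; rewrite !ord1 !mxE -[RHS]c0 /c; congr (x _ _).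
  exact: val_inj.
have eB x y : e (x - y) = e x - e y.
  symmetry; apply: (etrans (congr1 (+%R (e x)) (opp_row_mx (0 : 'rV_1) y))).
  by apply: (etrans (add_row_mx (0 : 'rV_1) x (- 0) (- y))); rewrite oppr0 addr0.
have rD x y : r (x + y) = r x + r y by exact: raddfD.
have rN x : r (- x) = - r x by exact: raddfN.
have rMn x n : r (x *+ n) = r x *+ n by exact: raddfMn.
have rMz x n : r (x *~ n) = r x *~ n by exact: raddfMz.
have cD x y : c (x + y) = c x + c y by rewrite /c mxE.
have cN x : c (- x) = - c x by rewrite /c mxE.
have cMn x n : c (x *+ n) = c x * n%:Z by rewrite /c mulmxnE -mulr_natr natz.
have cMz x t : c (x *~ t) = c x * t by rewrite /c -scaler_int mxE intz mulrC.
have sD : add_subgroup (c @` L).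
  split; first by exists 0; [exact: sL.1|rewrite /c mxE].
  move=> _ _ [x Lx <-] [y Ly <-]; exists (x - y); first exact: sL.2.
  by rewrite /c !mxE.
have [d [l0 Ll0 cl0] dD] := int_subgroup_gen sD.
have [/dvdzP [q aq]|nda] := boolP (d %| c a)%Z; last first.
  pose m := if d == 0 then `|c a|%N.+1 else `|d|%N.
  exists m; first by rewrite /m; case: eqP => // /eqP; rewrite absz_gt0.
  move=> w Lw; have : (d %| c a - c w *+ m)%Z.
    by apply: dD; exists (a - w *+ m) => //; rewrite cD cN /c mulmxnE.
  rewrite /m; move: nda; have [->|d0] := eqVneq d 0.
    rewrite !dvd0z => ca0 /eqP; move: ca0; set x := c a; set y := c w.
    rewrite -mulr_natr; have [->|] := eqVneq y 0; first by lia.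
    nia.
  move=> /negP nda dw; apply: nda; rewrite -[c a](subrK (c w *+ `|d|)) rpredD //.
  by rewrite -mulr_natr natz dvdz_mull // dvdzE.
pose a' := a - l0 *~ q.
have ca' : c a' = 0.
  by rewrite /a' cD cN cMz cl0 aq mulrC subrr.
have sL' : add_subgroup [set y | L (e y)].
  split; first by rewrite /= /e row_mx0; exact: sL.1.
  by move=> x y Lx Ly; rewrite /= eB; exact: sL.2.
have La' : ~ L (e (r a')).
  rewrite -cE // => La'; apply: La; rewrite -[a](subrK (l0 *~ q)).
  by apply: add_subgroupD => //; exact: add_subgroupMz.
have [n n0 nsep] := IH _ sL' _ La'.
pose m := if d == 0 then n else (n * `|d|)%N.
exists m; first by rewrite /m; case: eqP => // /eqP d0; rewrite muln_gt0 n0 absz_gt0.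
move=> w Lw.
have La'w : L (a' - w *+ m).
  by rewrite /a' addrAC; apply sL.2 => //; exact: add_subgroupMz.
have [j [t [mE tE]]] : exists j (t : int), m = (j * n)%N /\ c w * m%:Z = t * d * n%:Z.
  rewrite /m; have [d0|d0] := eqVneq d 0; last first.
    exists `|d|%N, (c w * Num.sg d); rewrite mulnC; split=> //.
    by rewrite PoszM; have := numEsg d; lia.
  exists 1%N, 0; rewrite mul1n; split=> //; rewrite !mul0r.
  have : (d %| c (a' - w *+ m))%Z by apply: dD; exists (a' - w *+ m).
  by rewrite {1}d0 dvd0z cD cN cMn ca' /m d0 eqxx sub0r oppr_eq0 => /eqP.
have := nsep (r w *+ j - r l0 *~ t); apply => /=.
have -> : r a' - (r w *+ j - r l0 *~ t) *+ n = r (a' - w *+ m + l0 *~ t *+ n).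
  rewrite (rD (a' - _)) (rD a') rN !rMn rMz mulrnBl -mulrnA -mE opprB -addrA.
  by congr (_ + _); rewrite addrC.
rewrite -cE.
  apply: (add_subgroupD sL) => //.
  exact/(add_subgroupMn sL)/(add_subgroupMz sL).
by rewrite (cD (a' - _)) (cD a') cN !cMn cMz cl0 ca' tE; ring.
Qed.
End AdditiveSeparation.

(** * Split extensions *)

Section SemidirectLERF.
Local Open Scope group_scope.
Local Open Scope classical_set_scope.
Variables (Q : groupType) (V : zmodType) (phi : zaction Q V).
Local Notation P := (sdprod phi).

Definition sd (v : V) (q : Q) : P := (v, q).
Definition sd_proj (x : P) : Q := x.2.

Lemma sdM v q w r : sd v q * sd w r = sd (v + phi q w)%R (q * r).
Proof. by []. Qed.

Lemma sdV v q : (sd v q)^-1 = sd (- phi (q^-1)%g v)%R q^-1.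
Proof. by []. Qed.

Lemma sd1 : sd 0%R 1 = 1.
Proof. by []. Qed.

Lemma sd_eta (x : P) : x = sd x.1 x.2.
Proof. by case: x. Qed.

Lemma sd_projM : {morph sd_proj : x y / x * y}.
Proof. by []. Qed.

Lemma sd_translationM : {morph (fun v => sd v 1) : v w / (v + w)%R >-> v * w}.
Proof. by move=> v w; rewrite sdM zact1 mulg1. Qed.

Lemma sd_translationMn v n : sd v 1 ^+ n = sd (v *+ n)%R 1.
Proof.
elim: n => [|n IH]; first by rewrite expg0 mulr0n.
by rewrite expgS IH -sd_translationM mulrS.
Qed.

Lemma sd_ldiv (x y : P) : sd_proj x = sd_proj y ->
  x^-1 * y = sd (- phi (x.2^-1)%g (x.1 - y.1))%R 1.
Proof.
case: x y => [v q] [w r]; rewrite /sd_proj /= => <-.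
rewrite -/(sd v q) -/(sd w q) sdV sdM mulVg; congr sd.
by rewrite raddfB opprB addrC.
Qed.

Hypothesis lerfQ : LERF Q.
Hypothesis sepV : add_subgroups_separable V.
Hypothesis congV : forall n, (0 < n)%N ->
  exists2 W : set P, finormal W & forall x, W x -> exists b, x.1 = (b *+ n)%R.

(** If the images of g and H in Q are not separated already, g may be replaced by
a translation a outside L = H :&: V. Choose n such that a is not in L + nV, hence
not in H nV, and a finite index normal subgroup W in which translation parts
are multiples of n. An element h1 of H in aW reduces the question to separating
h1^-1 a from H :&: W, and this can be done in Q: two elements of W with the same
image in Q differ by an element of nV. *)
Theorem LERF_sdprod : LERF P.
Proof.
move=> H fgH; have sH := fg_is_subgroup fgH.
apply/separableP => g Hg.
have [|ngQ] := pselect ((sd_proj @` H) (sd_proj g)); last first.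
  have /lerfQ/separableP/(_ _ ngQ) [N fN sepN] := fg_subgroup_image sd_projM fgH.
  exists (sd_proj @^-1` N); first exact: (finormal_preim sd_projM).
  move=> _ [n Nn <-] Hgn; apply: (sepN (sd_proj (g * n))).
    by exists (sd_proj n).
  by exists (g * n).
case=> h Hh hg; pose a := (g * h^-1).1.
have aE : sd a 1 = g * h^-1.
  by rewrite [RHS]sd_eta; congr sd; rewrite -/(sd_proj _) sd_projM (morphV sd_projM) hg mulgV.
pose L := [set v | H (sd v 1)].
have sL : add_subgroup L.
  split; first by rewrite /L /= sd1; exact: subgroup1.
  move=> v w Lv Lw; rewrite /L /= sd_translationM; apply: subgroupM => //.
  have -> : sd (- w)%R 1 = (sd w 1)^-1 by rewrite sdV invg1 zact1.
  exact: subgroupV.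
have La : ~ L a.
  by rewrite /L /= aE => Hgh; apply: Hg; rewrite -[g](mulgVK h); exact: subgroupM.
have [n n0 sepa] := sepV sL La.
have [W fW Wn] := congV n0.
suff [N fN sepN] : exists2 N, finormal N & lcoset N (sd a 1) `<=` ~` H.
  exists N => // _ [x Nx <-] Hgx.
  apply: (sepN (sd a 1 * (h * x * h^-1))).
    exists (h * x * h^-1) => //.
    case: fN => _ nN _; have := nN x h^-1 Nx.
    by rewrite conjgE invgK mulgA.
  rewrite aE !mulgA mulgVK; apply: subgroupM => //.
  exact: subgroupV.
have [[h1 [Hh1 [w Ww h1E]]]|noH] := pselect (exists h1, H h1 /\ lcoset W (sd a 1) h1); last first.
  by exists W => // x Wx Hx; apply: noH; exists x.
have [sW _ _] := fW.
have fgHW : fg_subgroup (H `&` W).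
  apply: (fg_subgroup_finite_index fgH (subgroupI sH sW) _ (finite_indexI sH fW)).
  by move=> ? [].
pose g1 := h1^-1 * sd a 1.
have Wg1 : W g1 by rewrite /g1 -h1E invgM mulgVK; exact: subgroupV.
have ng1 : ~ (sd_proj @` (H `&` W)) (sd_proj g1).
  case=> y [Hy Wy] yg1.
  have [b yb] := Wn _ Wy; have [b1 g1b] := Wn _ Wg1.
  apply: (sepa (phi h1.2 (b1 - b)%R)); rewrite -/(L _) /L /=.
  suff -> : sd (a - phi h1.2 (b1 - b) *+ n)%R 1 = h1 * y by exact: subgroupM.
  have h1a : h1 = sd a 1 * g1^-1 by rewrite /g1 invgM invgK mulVKg.
  have -> : h1.2 = g1.2^-1.
    by rewrite -/(sd_proj h1) h1a sd_projM mul1g (morphV sd_projM).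
  rewrite h1a -mulgA (sd_ldiv (esym yg1)) g1b yb -mulrnBl (raddfMn (phi _)).
  by rewrite sd_translationM.
have /lerfQ/separableP/(_ _ ng1) [N fN sepN] := fg_subgroup_image sd_projM fgHW.
exists (W `&` sd_proj @^-1` N).
  by apply: finormalI => //; exact: (finormal_preim sd_projM).
move=> _ [x [Wx Nx] <-] Hax.
apply: (sepN (sd_proj (g1 * x))); first by exists (sd_proj x).
exists (g1 * x) => //; split; last exact: subgroupM.
by rewrite /g1 -mulgA; apply: subgroupM => //; exact: subgroupV.
Qed.
End SemidirectLERF.

(** * A non-congruence subgroup of SL2(Z) *)

Section Exponents.
Local Open Scope nat_scope.

(** This sequence tends to 0 in the 2-adic integers and to 1/2 in the p-adic
integers for odd p. *)
Definition half_seq (m : nat) : nat := 2 ^ (m`!).-1.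

Lemma double_half_seq m : 2 * half_seq m = 2 ^ m`!.
Proof. by rewrite /half_seq -expnS prednK ?fact_gt0. Qed.

(** The modulus is split into its 2-part and its odd part; on the latter,
Euler's theorem applies since totient b divides m!. *)
Lemma half_seq_split c : 0 < c -> exists a b,
  [/\ c = 2 ^ a * b, coprime (2 ^ a) b, 0 < b & forall m, c <= m ->
    2 ^ a %| half_seq m /\ 2 * half_seq m = 1 %[mod b]].
Proof.
move=> c0; have [b co2b cE] := pfactor_coprime (isT : prime 2) c0.
set a := logn 2 c in cE; have b0 : 0 < b by move: c0; rewrite cE; case: b {co2b cE}.
exists a, b; split => //; first by rewrite mulnC.
  by rewrite coprimeXl.
move=> m cm; split.
  apply: dvdn_exp2l.
  have a2 : a < 2 ^ a by exact: ltn_expl.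
  have : 2 ^ a <= c by rewrite [X in _ <= X]cE leq_pmull.
  have : m <= m`!.
    by case: (m) => // k; apply: dvdn_leq; rewrite ?fact_gt0 ?dvdn_fact ?leqnn.
  lia.
have tb : totient b <= b.
  rewrite totient_count_coprime -[X in _ <= X](card_ord b) -sum1_card.
  by rewrite big_mkord leq_sum // => i _; case: coprime.
have /dvdnP [k mE] : totient b %| m`!.
  apply: dvdn_fact; rewrite totient_gt0 b0 (leq_trans tb) // (leq_trans _ cm) //.
  by rewrite [X in _ <= X]cE leq_pmulr // expn_gt0.
rewrite double_half_seq mE mulnC expnM -modnXm.
by rewrite cyclic.Euler_exp_totient // modnXm exp1n.
Qed.

Lemma half_seq_cauchy c m : 0 < c -> c <= m -> half_seq m = half_seq c %[mod c].
Proof.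
move=> c0; have [a [b [-> co b0 ab]]] := half_seq_split c0 => cm.
have [am bm] := ab _ cm; have [ac bc] := ab _ (leqnn _).
apply/eqP; rewrite chinese_remainder //; apply/andP; split.
  by rewrite (eqnP am) (eqnP ac).
set d := 2 ^ a * b in ac bc *.
have e1 : half_seq m * (2 * half_seq d) = half_seq m %[mod b].
  by rewrite -modnMmr bc modnMmr muln1.
have e2 : half_seq m * (2 * half_seq d) = half_seq d %[mod b].
  by rewrite mulnCA mulnA -modnMml bm modnMml mul1n.
by rewrite -e1 e2.
Qed.

Lemma half_seq_mod7 m : 7 <= m -> half_seq m = 4 %[mod 7].
Proof.
move=> m7; have /dvdnP [k mE] : 3 %| m`! by apply: dvdn_fact; rewrite (leq_trans _ m7).
have [j kE] : exists j, k = j.+1.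
  by exists k.-1; rewrite prednK //; have := fact_gt0 m; rewrite mE; case: (k).
have -> : half_seq m = 2 ^ (3 * j + 2).
  by rewrite /half_seq mE kE mulnC mulnS; congr (2 ^ _); lia.
by rewrite expnD expnM -modnMml -modnXm exp1n.
Qed.

Lemma half_seq_dvd c m : 0 < c -> c <= m -> c %| half_seq m * (4 * half_seq m ^ 2 - 1).
Proof.
move=> c0; have [a [b [-> _ b0 ab]]] := half_seq_split c0 => cm.
have [am bm] := ab _ cm; apply: dvdn_mul => //.
have -> : 4 * half_seq m ^ 2 = (2 * half_seq m) ^ 2 by rewrite expnMn.
rewrite -eqn_mod_dvd; first by rewrite -modnXm bm modnXm exp1n.
by rewrite double_half_seq expn_gt0 expn_gt0.
Qed.
End Exponents.

Section Word.
Local Open Scope classical_set_scope.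
Local Notation Q := (SL 2 int).
Local Open Scope ring_scope.

Fact slL_subproof (k : int) : 1 * 1 - 0 * k = 1. Proof. by rewrite mul0r subr0 mulr1. Qed.
Definition slL k : Q := sl2 (slL_subproof k).

Lemma slLD j k : (slL j * slL k)%g = slL (j + k).
Proof. by apply: SL_inj; rewrite SL_valM /= mulmx2; congr mx2; ring. Qed.

Lemma slL0 : slL 0 = 1%g.
Proof. by apply: SL_inj; rewrite /= mx2_1. Qed.

Lemma slLV k : (slL k)^-1%g = slL (- k).
Proof. by apply: (mulgI (slL k)); rewrite mulgV slLD subrr slL0. Qed.

Lemma slLX k n : (slL k ^+ n)%g = slL (k *+ n).
Proof.
by elim: n => [|n IH]; rewrite ?slL0 // expgS IH slLD mulrS.
Qed.

(** With T and L the elementary unipotent matrices, this is (T^(4y) L^(-y))^6. When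
y stands for 1/2, it is the sixth power of T^2 L^(-1/2), an element of order 6. *)
Definition half_word (y : nat) : Q := ((slT 4 ^+ y * slL (-1) ^+ y) ^+ 6)%g.

(** A = T^(4y) L^(-y) has determinant 1 and trace t = 2 - 4 y^2, and A - 1 is a
multiple of y. By Cayley-Hamilton, A^6 - 1 is the sum of t (t^2 - 1) (t^2 - 3) (A - 1)
and the scalar (t - 1) (t - 2) (t^3 + 2 t^2 - 1), where t - 1 = 1 - 4 y^2 and
t - 2 = - 4 y^2. *)
Lemma half_word_congruence (y : nat) : exists B : 'M[int]_2,
  SLval (half_word y) = 1%:M + (y%:Z * (4 * y%:Z ^+ 2 - 1)) *: B.
Proof.
pose x := y%:Z; pose t := 2 - 4 * x ^+ 2.
pose e := t * (t + 1) * (t ^+ 2 - 3); pose d := - 4 * x * (t ^+ 3 + 2 * t ^+ 2 - 1).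
exists (mx2 (4 * x * e - d) (- 4 * e) e (- d)).
have -> : half_word y = ((slT (4 * x)%R * slL (- x)%R) ^+ 6)%g.
  by rewrite /half_word slTX slLX; congr ((slT _ * slL _) ^+ 6)%g; rewrite /x; lia.
have scale2 k a b c f : k *: mx2 a b c f = mx2 (k * a) (k * b) (k * c) (k * f) :> 'M[int]_2.
  by rewrite [LHS]mx2_eta !mxE.
have add2 a b c f a' b' c' f' :
    mx2 a b c f + mx2 a' b' c' f' = mx2 (a + a') (b + b') (c + c') (f + f') :> 'M[int]_2.
  by rewrite [LHS]mx2_eta !mxE.
rewrite -mx2_1 scale2 add2 -/x.
set A := (slT _ * _)%g.
have -> : (A ^+ 6)%g = (A * A * (A * A) * (A * A))%g by rewrite !expgS expg0 mulg1 !mulgA.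
rewrite !SL_valM /= !mulmx2 /d /e /t; congr mx2; ring.
Qed.

(** Modulo N, the word only depends on the exponent y modulo c. *)
Lemma half_word_modn (N : set Q) c y y' : subgroup N -> (forall x g, N x -> N (x ^ g)%g) ->
  N (slT 4 ^+ c)%g -> N (slL (-1) ^+ c)%g -> y = y' %[mod c] ->
  N ((half_word y)^-1 * half_word y')%g.
Proof.
move=> sN nN NT NL yy'; pose E (a b : Q) := N (a^-1 * b)%g.
have EM a a' b b' : E a a' -> E b b' -> E (a * b)%g (a' * b')%g.
  move=> Ea Eb; rewrite /E.
  have -> : ((a * b)^-1 * (a' * b') = (a^-1 * a') ^ b * (b^-1 * b'))%g.
    by rewrite conjgE invgM -!mulgA mulVKg.
  by apply: subgroupM => //; exact: nN.
have EX a b n : E a b -> E (a ^+ n)%g (b ^+ n)%g.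
  move=> Eab; elim: n => [|n IH]; last by rewrite !expgS; exact: EM.
  by rewrite /E !expg0 mulVg; exact: subgroup1.
have Emod x n : N (x ^+ c)%g -> E (x ^+ (n %% c))%g (x ^+ n)%g.
  move=> Nx; rewrite /E [in X in (_ * X)%g](divn_eq n c) addnC expgnDr mulKg.
  by rewrite mulnC expgnA; exact: subgroupX.
have Ey x : N (x ^+ c)%g -> E (x ^+ y)%g (x ^+ y')%g.
  move=> Nx; have E1 := Emod x y Nx; have E2 := Emod x y' Nx.
  rewrite -yy' in E2; rewrite /E.
  have -> : ((x ^+ y)^-1 * x ^+ y' = ((x ^+ (y %% c))^-1 * x ^+ y)^-1 *
      ((x ^+ (y %% c))^-1 * x ^+ y'))%g by rewrite invgM invgK -!mulgA mulVKg.
  by apply: subgroupM => //; exact: subgroupV.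
by apply: EX; apply: EM; exact: Ey.
Qed.

Definition perm9 (l : seq nat) (i : 'I_9) : 'I_9 :=
  Ordinal (ltn_pmod (nth 0%N l i) (isT : 0 < 9)%N).

(** These permutations have orders 2 and 3. The corresponding unipotents have two
fixed points and one cycle of length 7 each. *)
Definition s9 := perm9 [:: 1; 0; 8; 4; 3; 7; 6; 5; 2]%N.
Definition u9 := perm9 [:: 1; 2; 0; 4; 5; 3; 7; 8; 6]%N.

(** The kernel of an action on nine points of PSL2(Z). As T and L have order 7 there,
a power T^y with 2y = 1 modulo 7 is T^4. The word for y = 4 therefore has the same
image as the words with exponents half_seq m, although these tend to 1 for
congruences; it moves the point 0. *)
Lemma noncongruence_subgroup : exists N : set Q,
  [/\ finormal N, N (slT 4 ^+ 7)%g, N (slL (-1) ^+ 7)%g & ~ N (half_word 4)].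
Proof.
have s9_2 x : s9 (s9 x) = x.
  by apply: val_inj; case: x => [[|[|[|[|[|[|[|[|[|?]]]]]]]]] ?].
have u9_3 x : u9 (u9 (u9 x)) = x.
  by apply: val_inj; case: x => [[|[|[|[|[|[|[|[|[|?]]]]]]]]] ?].
have [f [f1 fM fw]] := @SL2Z_action 'I_9 s9 u9
  (fun x => etrans (s9_2 _) (s9_2 x)) (fun x => etrans (s9_2 x) (esym (u9_3 x))).
have fX A n x : f (A ^+ n)%g x = iter n (f A) x.
  by elim: n => [|n IH]; rewrite ?f1 // expgS fM IH.
pose wT := [:: true; true; true; false].
pose wL := [:: true; true; true; false; false].
have TE : slT 4 = (word_eval wT ^+ 4)%g.
  by rewrite -[word_eval wT]/(slS * (slS * (slS * (slU * 1))))%g !mulgA mulg1 -slT1 slTX.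
have LE : slL (-1) = word_eval (word_inv wL).
  rewrite word_eval_inv -slLV; congr (_^-1)%g.
  rewrite -[word_eval wL]/(slS * (slS * (slS * (slU * (slU * 1)))))%g mulg1.
  by apply: SL_inj; rewrite !SL_valM /= !mulmx2; congr mx2.
exists [set A | forall x, x \in enum 'I_9 -> f A x = x]; split.
- by apply: (@finormal_fix _ 'I_9 f f1 fM) => A x _; rewrite mem_enum.
- move=> x _ /=; rewrite TE -expgnA fX (eq_iter (fw _)).
  by apply: val_inj; case: x => [[|[|[|[|[|[|[|[|[|?]]]]]]]]] ?].
- move=> x _ /=; rewrite LE fX (eq_iter (fw _)).
  by apply: val_inj; case: x => [[|[|[|[|[|[|[|[|[|?]]]]]]]]] ?].
- move=> /(_ ord0); rewrite mem_enum => /(_ isT); rewrite /half_word fX.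
(* what remains is a computation with permutations of nine points *)
  rewrite (@eq_iter _ _ (fun x => iter 16 (word_act s9 u9 wT)
    (iter 4 (word_act s9 u9 (word_inv wL)) x))).
    by move/(congr1 val).
  move=> x; rewrite fM TE LE -expgnA !fX.
  by rewrite (eq_iter (fw _)) (eq_iter (fw (word_inv _))).
Qed.
End Word.

(** * Closures in the profinite completion *)

Section Completion.
Local Open Scope group_scope.
Local Open Scope classical_set_scope.
Variable G : groupType.
Implicit Types (x z : profinite_completion G) (N M : finormal_of G).

Lemma finormal_ofP N : finormal (set_val N).
Proof. exact: set_valP. Qed.

(** A point of the completion is a coherent family of cosets. *)
Definition component x N : set G :=
  set_val ((set_val x : prod_topology (@quotient_of G)) N).

Lemma componentS x N M : set_val N `<=` set_val M -> component x N `<=` component x M.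
Proof. by move=> NM; have := set_valP x; apply. Qed.

Lemma component_coset x N : exists g, component x N = lcoset (set_val N) g.
Proof.
have [g _ gE] := set_valP ((set_val x : prod_topology (@quotient_of G)) N).
by exists g; exact: esym gE.
Qed.

Lemma component_mem x N g : component x N g -> component x N = lcoset (set_val N) g.
Proof.
have [h ->] := component_coset x N; move=> /lcosetE hg.
by apply: lcoset_eq => //; have [] := finormal_ofP N.
Qed.

Lemma component_eqS x z N M : set_val N `<=` set_val M ->
  component z N = component x N -> component z M = component x M.
Proof.
move=> NM zx; have [g xg] := component_coset x N.
have Ng : component x N g by rewrite xg; apply: lcoset_refl; have [] := finormal_ofP N.
rewrite (component_mem (componentS NM Ng)); apply: component_mem.
by apply: (componentS NM); rewrite zx.
Qed.

Lemma component_inj x N z : component z N = component x N ->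
  (set_val z : prod_topology (@quotient_of G)) N = (set_val x : prod_topology (@quotient_of G)) N.
Proof. by move=> h; apply: val_inj. Qed.

(** In a product, finitely many components are needed to bound a neighborhood; as
finite index normal subgroups are closed under intersection, a single one is
enough. *)
Lemma completion_nbhs x (A : set (profinite_completion G)) :
  nbhs x A <-> exists N, [set z | component z N = component x N] `<=` A.
Proof.
split; last first.
  move=> [N NA]; apply: (filterS NA); pose xN := (set_val x : prod_topology (@quotient_of G)) N.
  apply: (@filterS _ (nbhs x) _ ((fun z : profinite_completion G =>
    (set_val z : prod_topology (@quotient_of G)) N) @^-1` [set xN])).
    by move=> z /= zx; rewrite /component zx.
  have cval : continuous (set_val : profinite_completion G -> prod_topology (@quotient_of G)).
    exact: initial_continuous.
  have cproj := @proj_continuous (finormal_of G) (@quotient_of G) N.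
  apply: (cval x (proj N @^-1` [set xN])); apply: cproj.
  exact: discrete_set1.
move=> [_ [[B oB <-] Bx] BA].
pose F := filter_from [set: finormal_of G]
  (fun N => (set_val : profinite_completion G -> prod_topology (@quotient_of G)) @`
     [set z | component z N = component x N]).
have FF : Filter F.
  apply: filter_from_filter; first by exists (SigSub (mem_set (finormalT G))).
  move=> N M _ _; exists (SigSub (mem_set (finormalI (finormal_ofP N) (finormal_ofP M)))) => //.
  by move=> _ [z zx <-]; split; exists z => //; apply: component_eqS zx => g [].
have Fx : F --> (set_val x : prod_topology (@quotient_of G)).
  apply/cvg_sup => N C [_ [[D oD <-] Dx] DC].
  exists N => // _ [z zx <-]; apply: DC => /=.
  by rewrite (component_inj zx).
have [N _ NB] : F B by apply: Fx; apply: open_nbhs_nbhs; split.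
by exists N => z zx; apply: BA; apply: NB; exists z.
Qed.

Lemma closure_completion (H : set G) x :
  closure (@to_completion G @` H) x <-> forall N, exists2 h, H h & component x N h.
Proof.
split=> [clx N|Hx A /completion_nbhs [N NA]].
  have /clx [_ [[h Hh <-]]] : nbhs x [set z | component z N = component x N].
    by apply/completion_nbhs; exists N.
  move=> /= hx; exists h => //; rewrite -hx.
  by apply: lcoset_refl; have [] := finormal_ofP N.
have [h Hh xh] := Hx N; exists (to_completion h); split; first by exists h.
by apply: NA; rewrite /= (component_mem xh).
Qed.

(** A sequence that is eventually constant in each finite quotient has a limit. *)
Lemma completion_limit (a : nat -> G) :
  (forall N : set G, finormal N -> exists m0, forall m, (m0 <= m)%N -> N ((a m0)^-1 * a m)) ->
  exists x, forall N, exists m0, forall m, (m0 <= m)%N -> component x N (a m).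
Proof.
move=> cauchy.
pose m0 (N : finormal_of G) := sval (cid (cauchy _ (finormal_ofP N))).
have m0P N m : (m0 N <= m)%N -> lcoset (set_val N) (a (m0 N)) (a m).
  by move=> le_m; apply/lcosetE; rewrite /m0 in le_m *; case: cid le_m => /= k; apply.
pose y : prod_topology (@quotient_of G) :=
  fun N => SigSub (mem_set (imageT (lcoset (set_val N)) (a (m0 N)))).
have cy : compatible y.
  move=> N M NM; rewrite /y !set_valE /=.
  have sN : subgroup (set_val N) by have [] := finormal_ofP N.
  have sM : subgroup (set_val M) by have [] := finormal_ofP M.
  pose m := maxn (m0 N) (m0 M).
  have /lcosetE/(lcoset_eq sN) -> := m0P N m (leq_maxl _ _).
  have /lcosetE/(lcoset_eq sM) -> := m0P M m (leq_maxr _ _).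
  by move=> g /lcosetE Ng; apply/lcosetE/NM.
exists (SigSub (mem_set cy)) => N; exists (m0 N) => m /m0P.
by [].
Qed.

(** The sequences a in H and b in K have the same limit, which lies outside the
closure of M and so outside the closure of the trivial group. *)
Lemma not_wilson_zalesskii (H K : set G) (a b : nat -> G) (M : set G) :
  fg_subgroup H -> fg_subgroup K -> H `&` K = [set 1] ->
  (forall m, H (a m)) -> (forall m, K (b m)) ->
  (forall N : set G, finormal N -> exists m0, forall m, (m0 <= m)%N ->
     N ((a m0)^-1 * a m) /\ N ((b m)^-1 * a m)) ->
  finormal M -> (exists m0, forall m, (m0 <= m)%N -> ~ M (a m)) ->
  ~ wilson_zalesskii G.
Proof.
move=> fgH fgK HK aH bK ab fM [m1 aM] wz.
have [|x xa] := @completion_limit a.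
  by move=> N /ab [m0 abm]; exists m0 => m /abm [].
have : closure (@to_completion G @` (H `&` K)) x.
  rewrite -wz //; split; apply/closure_completion => N; have [m0 xam] := xa N.
    by exists (a m0); [|exact: xam].
  have fN := finormal_ofP N; have [sN _ _] := fN.
  have [m2 abm] := ab _ fN; pose m := maxn m0 m2.
  exists (b m) => //; have xm : component x N (a m) by apply: xam; exact: leq_maxl.
  rewrite (component_mem xm); apply/lcosetE; rewrite -[b m]invgK -invgM.
  by apply: subgroupV => //; have [|] := abm m; first exact: leq_maxr.
rewrite HK => /closure_completion /(_ (SigSub (mem_set fM))) [_ -> x1].
have [m0 xam] := xa (SigSub (mem_set fM)); pose m := maxn m0 m1.
apply: (aM m); first exact: leq_maxr.
have := xam m (leq_maxl _ _); rewrite (component_mem x1) => /lcosetE.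
by rewrite invg1 mul1g.
Qed.
End Completion.

(** * The affine group of integral two by two matrices *)

Section Transport.
Local Open Scope group_scope.
Variables (Q : groupType) (V W : zmodType) (phi : zaction Q V).
Variables (f : {additive V -> W}) (g : {additive W -> V}).
Hypotheses (fK : cancel f g) (gK : cancel g f).

(** The theorem asks for an action on column vectors of size four, whereas the
construction lives on two by two matrices. *)
Lemma zaction_transport : exists psi : zaction Q W, isomorphic (sdprod phi) (sdprod psi).
Proof.
have act1 w : (f \o (phi 1 \o g)) w = w by rewrite /= zact1 gK.
have actM a b w : (f \o (phi (a * b) \o g)) w =
    (f \o (phi a \o g)) ((f \o (phi b \o g)) w) by rewrite /= fK zactM.
pose psi := @ZAction Q W (fun q => (f \o (phi q \o g) : {additive W -> W})%FUN) act1 actM.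
exists psi.
pose F (x : sdprod phi) : sdprod psi := sd psi (f x.1) x.2.
have FM : {morph F : x y / x * y}.
  by move=> x y; rewrite /F sdM /= fK -raddfD.
pose Fm := isMultiplicative.Build _ _ F FM.
pose Fmm : {multiplicative (sdprod phi) -> (sdprod psi)} := HB.pack F Fm.
exists Fmm; exists (fun y => sd phi (g y.1) y.2).
- by case=> v q; rewrite /= /sd fK.
- by case=> v q; rewrite /= /F /sd /= gK.
Qed.
End Transport.

Section MatrixGroup.
Local Open Scope group_scope.
Local Open Scope classical_set_scope.
Local Notation Q := (SL 2 int).
Local Notation V := 'M[int]_2.

Lemma mx_action1 (v : V) : (mulmx (SLval (1%g : Q)) v = v)%R.
Proof. exact: mul1mx. Qed.

Lemma mx_actionM (a b : Q) (v : V) :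
  (mulmx (SLval (a * b)%g) v = mulmx (SLval a) (mulmx (SLval b) v))%R.
Proof. by rewrite SL_valM mulmxA. Qed.

Definition mx_action : zaction Q V :=
  @ZAction Q V (fun q => mulmx (SLval q) : {additive V -> V}) mx_action1 mx_actionM.

Local Notation G := (sdprod mx_action).

Lemma mx_actionE q v : mx_action q v = (SLval q *m v)%R.
Proof. by []. Qed.

Lemma mx_subgroups_separable : add_subgroups_separable V.
Proof.
move=> L sL a La.
pose L' := [set x : 'rV[int]_(2 * 2) | L (vec_mx x)].
have sL' : add_subgroup L'.
  split; first by rewrite /L' /= linear0; exact: sL.1.
  by move=> x y Lx Ly; rewrite /L' /= linearB; exact: sL.2.
have La' : ~ L' (mxvec a) by rewrite /L' /= mxvecK.
have [n n0 sep] := rV_subgroups_separable sL' La'.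
exists n => // w Lw; apply: (sep (mxvec w)).
by rewrite /L' /= linearB linearMn /= !mxvecK.
Qed.

Lemma intr_Zp_eq0 n (x : int) : (x%:~R = 0 :> 'Z_n.+2)%R -> exists y, x = (y * n.+2%:Z)%R.
Proof.
have nat_case m : (m%:R = 0 :> 'Z_n.+2)%R -> exists y, (m%:Z = y * n.+2%:Z)%R.
  move=> /(congr1 val); rewrite /= val_Zp_nat // => /eqP/dvdnP [k ->].
  by exists (Posz k); rewrite PoszM.
case: x => m; first exact: nat_case.
rewrite NegzE rmorphN /= => /eqP; rewrite oppr_eq0 => /eqP/nat_case [y ->].
by exists (- y)%R; rewrite mulNr.
Qed.

Definition reduce n (A : V) : 'M['Z_n.+2]_2 := map_mx intr A.

Lemma reduce_eq0 n A : reduce n A = 0%R -> exists B, A = (B *+ n.+2)%R.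
Proof.
move=> A0.
have An i j : exists y, A i j = (y * n.+2%:Z)%R.
  by apply: intr_Zp_eq0; have /matrixP/(_ i j) := A0; rewrite !mxE.
exists (\matrix_(i, j) sval (cid (An i j)))%R.
apply/matrixP => i j; rewrite mulmxnE mxE; case: cid => y /= ->.
by rewrite -mulr_natr natz.
Qed.

(** The kernel of the affine action of G on matrices modulo n + 2; the shift keeps
the ring of residues nontrivial. *)
Lemma congruence_finormal n : exists2 W : set G, finormal W &
  forall x, W x -> reduce n x.1 = 0%R /\ reduce n (SLval x.2) = 1%:M%R.
Proof.
pose f (x : G) (m : 'M['Z_n.+2]_2) := (reduce n x.1 + reduce n (SLval x.2) *m m)%R.
have f1 m : f 1 m = m.
  by rewrite /f /reduce /= map_mx0 add0r map_mx1 mul1mx.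
have fM x y m : f (x * y) m = f x (f y m).
  by rewrite /f /reduce /= map_mxD !map_mxM mulmxDr addrA mulmxA.
exists [set x | forall m, m \in enum 'M['Z_n.+2]_2 -> f x m = m].
  by apply: (finormal_fix f1 fM) => x m _; rewrite mem_enum.
move=> x fx; have fx' m : f x m = m by apply: fx; rewrite mem_enum.
have x0 : reduce n x.1 = 0%R by have := fx' 0%R; rewrite /f mulmx0 addr0.
by split=> //; have := fx' 1%:M%R; rewrite /f x0 add0r mulmx1.
Qed.

Lemma LERF_affine : LERF G.
Proof.
apply: LERF_sdprod; [exact: LERF_SL2Z|exact: mx_subgroups_separable|] => n n0.
have [W fW Wn] := congruence_finormal (n * 2).-2; exists W => // x /Wn [/reduce_eq0 [B ->] _].
exists (B *+ 2)%R; rewrite -mulrnA; congr (_ *+ _)%R; lia.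
Qed.

(** These elements act on V as affine maps with linear part q, fixing the matrix 0
and the matrix 1 respectively. *)
Definition fix0 (q : Q) : G := sd mx_action 0%R q.
Definition fix1 (q : Q) : G := sd mx_action (1%:M - SLval q)%R q.

Lemma fix0M : {morph fix0 : x y / x * y}.
Proof. by move=> x y; rewrite /fix0 sdM raddf0 addr0. Qed.

Lemma fix1M : {morph fix1 : x y / x * y}.
Proof.
move=> x y; rewrite /fix1 sdM mx_actionE SL_valM mulmxBr mulmx1; congr sd.
by rewrite addrA subrK.
Qed.

Definition stab0 : set G := range fix0.
Definition stab1 : set G := range fix1.

Lemma fg_SL2Z : fg_subgroup [set: Q].
Proof.
exists [set slS; slU]; first exact: finite_set2.
apply/seteqP; split=> // A _; have [w <-] := SL2Z_generated A.
elim: w => [|b w IH]; first exact: (subgroup1 (@subgroup_smallest _ _)).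
have -> : word_eval (b :: w) = (if b then slS else slU) * word_eval w.
  by rewrite /word_eval /=; case: b.
have gb : [set slS; slU] (if b then slS else slU) by case: b; [left|right].
exact: (subgroupM (@subgroup_smallest _ _) (sub_gen_smallest gb) IH).
Qed.

Lemma fg_stab0 : fg_subgroup stab0. Proof. exact: (fg_subgroup_image fix0M fg_SL2Z). Qed.
Lemma fg_stab1 : fg_subgroup stab1. Proof. exact: (fg_subgroup_image fix1M fg_SL2Z). Qed.

Lemma stab0I1 : stab0 `&` stab1 = [set 1].
Proof.
apply/seteqP; split=> [x [[q _ <-] [r _ /= rE]]|x ->]; last first.
  by split; exists 1; rewrite ?(morph1 fix0M) ?(morph1 fix1M).
have r1 : r = 1.
  apply: SL_inj; have := congr1 fst rE; rewrite /= => /eqP.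
  by rewrite subr_eq0 => /eqP <-.
by have := congr1 snd rE => /= <-; rewrite r1 (morph1 fix0M).
Qed.

(** An element x lies in the double coset if and only if the image x.1 + x.2 of the
identity matrix under x lies in the orbit SL2(Z) of that matrix. *)
Lemma mem_stab01 x : set_mulg stab0 stab1 x <-> (\det (x.1 + SLval x.2) = 1)%R.
Proof.
split.
  move=> [_ [q _ <-] [_ [r _ <-] <-]]; rewrite /= add0r mx_actionE mulmxBr mulmx1 subrK.
  exact: det_SL.
move=> d1; pose q : Q := MkSL (introT eqP d1).
exists (fix0 q); first by exists q.
exists (fix1 (q^-1 * x.2)); first by exists (q^-1 * x.2).
rewrite sdM add0r mx_actionE mulmxBr mulmx1 -SL_valM mulVKg /= addrK.
by rewrite -sd_eta.
Qed.

(** If the determinant differs from 1 by e, it differs from 1 modulo every integer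
larger than |e|. *)
Lemma separable_stab01 : separable (set_mulg stab0 stab1).
Proof.
apply/separableP => x; rewrite mem_stab01 => dx.
pose e : int := (\det (x.1 + SLval x.2) - 1)%R.
have e0 : e != 0%R by rewrite subr_eq0; apply/eqP.
have [W fW Wn] := congruence_finormal `|e|%N.
exists W => // _ [w /Wn [w1 w2] <-] /mem_stab01; rewrite /= mx_actionE => d1.
have : (e%:~R = 0 :> 'Z_(`|e|%N).+2)%R.
  rewrite rmorphB /= -d1 -!det_map_mx !map_mxD /= !map_mxM /= -/(reduce _ w.1).
  rewrite w1 mulmx0 addr0 -/(reduce _ (SLval w.2)) w2 mulmx1.
  by rewrite subrr.
move/intr_Zp_eq0 => [y ey].
have := congr1 absz ey; rewrite abszM /=; move: e0 ey; rewrite -absz_eq0.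
by case: y => [[|y]|y]; nia.
Qed.

(** The quotient of the two lifts of q is the translation by 1 - q^-1, which is a
multiple of c when q is 1 modulo c. *)
Lemma fix1_fix0_near (N : set G) : finormal N -> exists2 c, (0 < c)%N &
  forall q (B : V), (SLval q = 1%:M + c%:Z *: B)%R -> N ((fix1 q)^-1 * fix0 q).
Proof.
move=> /finormal_exponent [c c0 Nc]; exists c => // q B qE.
rewrite sd_ldiv // mx_actionE /= subr0.
have -> : (- (SLval (q^-1)%g *m (1%:M - SLval q)))%R = ((SLval (q^-1)%g *m B) *+ c)%R.
  rewrite qE opprD addrA subrr add0r mulmxN opprK -scalemxAr.
  by rewrite -scaler_nat natz.
by rewrite -sd_translationMn; exact: Nc.
Qed.

Definition half_word_seq m : Q := half_word (half_seq m).

(** In each finite quotient of G, the lifts of the sequence to the two stabilizers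
are eventually constant and equal to each other. *)
Lemma half_word_seq_limit (N : set G) : finormal N -> exists m0, forall m, (m0 <= m)%N ->
  N ((fix0 (half_word_seq m0))^-1 * fix0 (half_word_seq m)) /\
  N ((fix1 (half_word_seq m))^-1 * fix0 (half_word_seq m)).
Proof.
move=> fN; have [sN nN _] := fN.
have [c c0 Nc] := fix1_fix0_near fN.
have [d d0 Nd] := finormal_exponent fN.
exists (maxn c d) => m; rewrite geq_max => /andP [cm dm]; split.
  have fN' := finormal_preim fix0M fN; have [sN' nN' _] := fN'.
  have := @half_word_modn (fix0 @^-1` N) d (half_seq (maxn c d)) (half_seq m) sN' nN'.
  rewrite /= fix0M (morphV fix0M); apply.
  - by rewrite (morphX fix0M); exact: Nd.
  - by rewrite (morphX fix0M); exact: Nd.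
  - by rewrite (half_seq_cauchy d0 dm) (half_seq_cauchy d0) // leq_maxr.
have [B hE] := half_word_congruence (half_seq m).
have /dvdnP [k kE] := half_seq_dvd c0 cm.
apply: (Nc _ (k%:Z *: B)%R); rewrite /half_word_seq hE; congr (_ + _)%R.
rewrite scalerA; congr (_ *: _)%R; rewrite -PoszM mulnC -kE.
have : (0 < 4 * half_seq m ^ 2)%N by rewrite muln_gt0 expn_gt0 expn_gt0.
by move=> ?; rewrite PoszM -subzn // PoszM expr2 mulnn.
Qed.

(** N0 stands for the subgroup found in noncongruence_subgroup; it contains no late
term of the sequence. *)
Section Noncongruence.
Variable N0 : set Q.
Hypothesis fN0 : finormal N0.
Hypotheses (NT : N0 (slT 4 ^+ 7)) (NL : N0 (slL (-1) ^+ 7)).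
Hypothesis Nh4 : ~ N0 (half_word 4).

Let sN0 : subgroup N0. Proof. by case: fN0. Qed.
Let nN0 x g : N0 x -> N0 (x ^ g). Proof. by case: fN0 => _ + _; apply. Qed.

Let N0_seq m : (7 <= m)%N -> N0 ((half_word 4)^-1 * half_word_seq m).
Proof. by move=> m7; apply: (half_word_modn sN0 nN0 NT NL); rewrite half_seq_mod7. Qed.

Let N0'_seq m : (7 <= m)%N -> ~ N0 (half_word_seq m).
Proof.
move=> /N0_seq Nm Nhm; apply: Nh4.
have -> : half_word 4 = half_word_seq m * ((half_word 4)^-1 * half_word_seq m)^-1.
  by rewrite invgM invgK mulVKg.
by apply: subgroupM => //; exact: subgroupV.
Qed.

Definition over_N0 : set G := sd_proj (phi := mx_action) @^-1` N0.

Lemma finormal_over_N0 : finormal over_N0.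
Proof. exact: (finormal_preim (sd_projM (phi := mx_action))). Qed.

Let sM : subgroup over_N0. Proof. by case: finormal_over_N0. Qed.

(** The element fix0 (half_word 4) is not in the double coset since its value at the
matrix 1 is not in N0. It is in the closure: with h a late term of the sequence,
fix0 (half_word 4 h^-1) is in the subgroup, and its product with fix1 h is close to
fix0 (half_word 4) because fix1 h is close to fix0 h. *)
Lemma not_separable_stab01 : ~ separable (set_mulg (stab0 `&` over_N0) stab1).
Proof.
move=> /separableP /(_ (fix0 (half_word 4))) [|N fN].
  move=> [_ [[q _ <-] Mq] [_ [r _ <-]]] /= qr.
  apply: Nh4; have := congr1 fst qr; have := congr1 snd qr => /= <-.
  rewrite add0r mx_actionE => r1.
  have r1' : r = 1.
    apply: SL_inj; rewrite SL_val1.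
    have := congr1 (mulmx (SLval q^-1)) r1.
    rewrite mulmx0 mulmxA -SL_valM mulVg SL_val1 mul1mx => /eqP.
    by rewrite subr_eq0 => /eqP <-.
  by rewrite r1' mulg1; exact: Mq.
have [m0 lim] := half_word_seq_limit fN; pose m := maxn m0 7.
have [_ Nm] := lim m (leq_maxl _ _); have [sN nN _] := fN.
have N0m := N0_seq (leq_maxr m0 7).
pose q := half_word 4 * (half_word_seq m)^-1.
move=> /(_ (fix0 q * fix1 (half_word_seq m))); apply.
  apply/lcosetE; rewrite /q fix0M (morphV fix0M) -!mulgA mulKg.
  by rewrite -[X in N X]invgK; apply: subgroupV => //; rewrite invgM invgK.
exists (fix0 q); last by exists (fix1 (half_word_seq m)) => //; exists (half_word_seq m).
split; first by exists q.
rewrite /over_N0 /= /sd_proj /= /q.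
have divE (x y : Q) : x * y^-1 = ((x^-1 * y) ^ x^-1)^-1.
  by rewrite conjgE invgK -mulgA mulVKg invgM invgK.
by rewrite divE; apply: subgroupV => //; exact: nN0.
Qed.

(** Late terms h of the sequence lie in both stab0 N and stab1 N, as fix0 h and
fix1 h agree modulo N, but they avoid over_N0. *)
Lemma not_tractable_stab01 : ~ profinitely_tractable stab0 stab1.
Proof.
move=> /(_ over_N0 finormal_over_N0) [N [fN NM]]; rewrite stab0I1 => tract.
have [m0 lim] := half_word_seq_limit fN; pose m := maxn m0 7.
have [_ Nm] := lim m (leq_maxl _ _); have [sN _ _] := fN.
have : set_mulg [set 1] over_N0 (fix0 (half_word_seq m)).
  apply: tract; split.
    exists (fix0 (half_word_seq m)); first by exists (half_word_seq m).
    by exists 1; [exact: subgroup1|rewrite mulg1].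
  exists (fix1 (half_word_seq m)); first by exists (half_word_seq m).
  by exists ((fix1 (half_word_seq m))^-1 * fix0 (half_word_seq m)); rewrite ?mulVKg.
move=> [_ -> [y My]]; rewrite mul1g => yE.
by apply: (N0'_seq (leq_maxr m0 7)); move: My; rewrite yE.
Qed.

Lemma not_wilson_zalesskii_affine : ~ wilson_zalesskii G.
Proof.
apply: (not_wilson_zalesskii (a := fix0 \o half_word_seq)
  (b := fix1 \o half_word_seq) fg_stab0 fg_stab1 stab0I1 _ _ _ finormal_over_N0).
- by move=> m; exists (half_word_seq m).
- by move=> m; exists (half_word_seq m).
- by move=> N /half_word_seq_limit.
- by exists 7 => m /N0'_seq.
Qed.

Lemma finite_index_stab0 : [/\ subgroup (stab0 `&` over_N0),
  stab0 `&` over_N0 `<=` stab0 & finite_index (stab0 `&` over_N0) stab0].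
Proof.
have sH := fg_is_subgroup fg_stab0.
split; [exact: subgroupI|by move=> x []|exact: finite_indexI finormal_over_N0].
Qed.

End Noncongruence.

Lemma stab01_counterexample :
  [/\ fg_subgroup stab0 /\ fg_subgroup stab1,
      stab0 `&` stab1 = [set 1],
      separable (set_mulg stab0 stab1),
      (exists H' : set G,
         [/\ subgroup H', H' `<=` stab0, finite_index H' stab0 &
             ~ separable (set_mulg H' stab1)]) &
      ~ profinitely_tractable stab0 stab1 /\ ~ wilson_zalesskii G].
Proof.
have [N0 [fN0 NT NL Nh4]] := noncongruence_subgroup.
split.
- by split; [exact: fg_stab0|exact: fg_stab1].
- exact: stab0I1.
- exact: separable_stab01.
- have [sH' H'H fH'] := finite_index_stab0 fN0.
  exists (stab0 `&` over_N0 N0); split => //.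
  exact: (not_separable_stab01 fN0 NT NL Nh4).
by split; [exact: (not_tractable_stab01 fN0 NT NL Nh4)
          |exact: (not_wilson_zalesskii_affine fN0 NT NL Nh4)].
Qed.

End MatrixGroup.

Local Open Scope group_scope.
Local Open Scope classical_set_scope.

Theorem mainTheorem4 :
  exists (G : groupType) (phi : zaction (SL 2 int) 'cV[int]_4),
    [/\ isomorphic G (sdprod phi), LERF G &
    exists H K : set G,
      [/\ fg_subgroup H /\ fg_subgroup K,
          H `&` K = [set 1],
          separable (set_mulg H K),
          (exists H' : set G,
             [/\ subgroup H', H' `<=` H, finite_index H' H &
                 ~ separable (set_mulg H' K)]) &
          ~ profinitely_tractable H K /\ ~ wilson_zalesskii G]].
Proof.
pose f (A : 'M[int]_2) : 'cV[int]_4 := (mxvec A)^T%R.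
pose g (v : 'cV[int]_4) : 'M[int]_2 := vec_mx (v^T : 'rV[int]_(2 * 2))%R.
have fB : {morph f : x y / (x - y)%R} by move=> x y; rewrite /f !linearB.
have gB : {morph g : x y / (x - y)%R} by move=> x y; rewrite /g !linearB.
pose fA : {additive 'M[int]_2 -> 'cV[int]_4} := HB.pack f (GRing.isZmodMorphism.Build _ _ f fB).
pose gA : {additive 'cV[int]_4 -> 'M[int]_2} := HB.pack g (GRing.isZmodMorphism.Build _ _ g gB).
have fK : cancel fA gA by move=> A; rewrite /= /f /g trmxK mxvecK.
have gK : cancel gA fA by move=> v; rewrite /= /f /g vec_mxK trmxK.
have [psi iso] := zaction_transport mx_action fK gK.
exists (sdprod mx_action), psi; split => //; first exact: LERF_affine.
by exists stab0, stab1; exact: stab01_counterexample.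
Qed.
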